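(* For each dimension $n$, there are only finitely many isomorphism classes of pairs of groups $(\Gamma,N)$ such that $\Gamma$ is an $n$-space group and $N$ is a normal subgroup of $\Gamma$ such that $\Gamma/N$ is a space group.
   Context: An $n$-space group (an $n$-dimensional crystallographic group) is a discrete group $\Gamma$ of isometries of Euclidean $n$-space $E^n$ whose orbit space $E^n/\Gamma$ is compact. A space group is a $k$-space group for some $k\ge 0$ ($E^0$ is a point); the phrase ''$\Gamma/N$ is a space group'' means that the abstract group $\Gamma/N$ is isomorphic to a $k$-space group for some $k$. Two pairs $(\Gamma_1,N_1)$ and $(\Gamma_2,N_2)$, with $N_i$ a normal subgroup of $\Gamma_i$, are isomorphic if there is a group isomorphism $\zeta:\Gamma_1\to\Gamma_2$ such that $\zeta(N_1)=N_2$. *)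

(* Defs.v *)
From HB Require Import structures.
From mathcomp Require Import all_boot all_order all_algebra generic_quotient.
From mathcomp Require Import all_classical all_reals all_analysis.

Set Implicit Arguments.
Unset Strict Implicit.
Unset Printing Implicit Defensive.

Import Order.TTheory GRing.Theory Num.Theory.
Import numFieldNormedType.Exports.
Local Open Scope quotient_scope.
Local Open Scope classical_set_scope.

Section Groups.
Local Open Scope group_scope.

Record subgroup (G : groupType) := Subgroup {
  subgroup_set :> set G;
  subgroup_closed : group_closed [in subgroup_set]
}.

Definition normal_subgroup (G : groupType) (N H : subgroup G) :=
  N `<=` H /\
  forall g x, subgroup_set H g -> subgroup_set N x -> subgroup_set N (x ^ g).

(* On the cosets of a normal subgroup, the elementwise product of subsets is the
   multiplication of the quotient group. *)
Definition set_mulg (G : magmaType) (A B : set G) : set G :=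
  [set x * y | x in A & y in B].

HB.instance Definition _ (G : magmaType) := hasMul.Build (set G) (@set_mulg G).

Definition quotient_group (G : groupType) (H N : subgroup G) : set (set G) :=
  [set [set g * x | x in N] | g in H].

(* The groups A and B are given as subsets of magmas, so that the same notion
   applies to subgroups and to groups of cosets; the values of f outside A are
   irrelevant. *)
Definition group_isomorphism (S T : magmaType) (A : set S) (B : set T)
    (f : S -> T) :=
  set_bij A B f /\ forall x y, A x -> A y -> f (x * y) = f x * f y.

Definition group_isomorphic (S T : magmaType) (A : set S) (B : set T) :=
  exists f : S -> T, group_isomorphism A B f.

Definition pair_isomorphic (G1 G2 : groupType)
    (p1 : subgroup G1 * subgroup G1) (p2 : subgroup G2 * subgroup G2) :=
  exists f : G1 -> G2, group_isomorphism p1.1 p2.1 f /\ f @` p1.2 = p2.2.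

End Groups.

Section Isometries.
Local Open Scope ring_scope.
Context (R : realType) (n : nat).

(* The library's norm on matrices is the sup norm; it induces the same topology
   as the Euclidean distance, but not the same isometries. *)
Definition edist (x y : 'rV[R]_n) : R :=
  Num.sqrt (\sum_(i < n) (x 0 i - y 0 i) ^+ 2).

Record euclid_isometry := EuclidIsometry {
  isometry_fun :> 'rV[R]_n -> 'rV[R]_n;
  isometry_edist :
    forall x y, edist (isometry_fun x) (isometry_fun y) = edist x y;
  isometry_bij : bijective isometry_fun
}.

Lemma isometryP (f g : euclid_isometry) : f =1 g -> f = g.
Proof.
case: f g => [f df bf] [g dg bg] /= /funext fg; subst g.
by congr EuclidIsometry; apply: Prop_irrelevance.
Qed.

Definition isometry_id : euclid_isometry :=
  @EuclidIsometry id (fun _ _ => erefl) (Bijective (frefl _) (frefl _)).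

Lemma isometry_comp_edist (f g : euclid_isometry) x y :
  edist ((f \o g) x) ((f \o g) y) = edist x y.
Proof. by rewrite /= !isometry_edist. Qed.

Definition isometry_comp (f g : euclid_isometry) : euclid_isometry :=
  EuclidIsometry (isometry_comp_edist f g)
    (bij_comp (isometry_bij f) (isometry_bij g)).

Lemma isometry_has_inv (f : euclid_isometry) :
  exists g : euclid_isometry, cancel f g /\ cancel g f.
Proof.
have [g fK gK] := isometry_bij f.
have dg x y : edist (g x) (g y) = edist x y.
  by rewrite -(isometry_edist f) !gK.
by exists (EuclidIsometry dg (Bijective gK fK)).
Qed.

Definition isometry_inv (f : euclid_isometry) : euclid_isometry :=
  sval (cid (isometry_has_inv f)).

Lemma isometry_compA : associative isometry_comp.
Proof. by move=> f g h; apply: isometryP. Qed.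

Lemma isometry_comp1f : left_id isometry_id isometry_comp.
Proof. by move=> f; apply: isometryP. Qed.

Lemma isometry_compf1 : right_id isometry_id isometry_comp.
Proof. by move=> f; apply: isometryP. Qed.

Lemma isometry_compVf : left_inverse isometry_id isometry_inv isometry_comp.
Proof.
move=> f; apply: isometryP => x /=; rewrite /isometry_inv.
by case: cid => g [/= fK _]; exact: fK.
Qed.

Lemma isometry_compfV : right_inverse isometry_id isometry_inv isometry_comp.
Proof.
move=> f; apply: isometryP => x /=; rewrite /isometry_inv.
by case: cid => g [/= _ gK]; exact: gK.
Qed.

HB.instance Definition _ := gen_eqMixin euclid_isometry.
HB.instance Definition _ := gen_choiceMixin euclid_isometry.
HB.instance Definition _ := isGroup.Build euclid_isometry
  isometry_compA isometry_comp1f isometry_compf1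
  isometry_compVf isometry_compfV.

HB.instance Definition _ := Topological.copy euclid_isometry
  (initial_topology
    (isometry_fun : euclid_isometry -> {compact-open, 'rV[R]_n -> 'rV[R]_n})).

End Isometries.

Section SpaceGroups.
Context (R : realType) (n : nat).

Section OrbitSpace.
Variable Gamma : subgroup (euclid_isometry R n).

Definition same_orbit (x y : 'rV[R]_n) : bool :=
  `[< exists2 g, subgroup_set Gamma g & g x = y >].

Lemma same_orbit_refl : reflexive same_orbit.
Proof.
move=> x; apply/asboolP; exists 1%g => //.
by have [/set_mem] := subgroup_closed Gamma.
Qed.

Lemma same_orbit_ltransfer x y z :
  same_orbit x y -> same_orbit x z -> same_orbit y z.
Proof.
move=> /asboolP[g /mem_set Gg <-] /asboolP[h /mem_set Gh <-].
apply/asboolP; exists (h / g)%g.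
  by apply: set_mem; have [_] := subgroup_closed Gamma; exact.
have /(congr1 (fun k : euclid_isometry R n => k x)) := mulVg g.
by move=> /= gK; congr (h _); exact: gK.
Qed.

Lemma same_orbit_sym : symmetric same_orbit.
Proof.
by move=> x y; apply/idP/idP => /same_orbit_ltransfer; apply;
  exact: same_orbit_refl.
Qed.

Lemma same_orbit_trans : transitive same_orbit.
Proof.
move=> y x z; rewrite same_orbit_sym => /same_orbit_ltransfer; exact.
Qed.

Canonical same_orbit_equiv :=
  EquivRel same_orbit same_orbit_refl same_orbit_sym same_orbit_trans.

Definition orbit_space := quotient_topology {eq_quot same_orbit}.

End OrbitSpace.

Definition space_group (Gamma : subgroup (euclid_isometry R n)) :=
  isolated (subgroup_set Gamma) = subgroup_set Gamma /\
  compact [set: orbit_space Gamma].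

End SpaceGroups.

Definition space_group_quotient (R : realType) (G : groupType)
    (H N : subgroup G) :=
  exists k (Delta : subgroup (euclid_isometry R k)),
    space_group Delta /\ group_isomorphic (quotient_group H N) Delta.

Definition space_group_pairs (R : realType) (n : nat) :
    set (subgroup (euclid_isometry R n) * subgroup (euclid_isometry R n)) :=
  [set p | [/\ space_group p.1, normal_subgroup p.2 p.1 &
    space_group_quotient R p.1 p.2]].

Arguments space_group_pairs R n : clear implicits.

(* The isomorphism class, within space_group_pairs R n, of the pair p. *)
Definition pair_class (R : realType) (n : nat)
    (p : subgroup (euclid_isometry R n) * subgroup (euclid_isometry R n)) :=
  [set q | space_group_pairs R n q /\ pair_isomorphic p q].

(* Main.v *)
(* By Bieberbach's first theorem an n-space group Gamma contains a lattice T of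
   translations, and the set of linear parts of Gamma is finite, of size bounded
   in terms of n. For a normal subgroup N such that Gamma / N is a space group,
   the subgroup L of T of the translations in N is pure, and N is determined by
   Gamma and L. In a basis of T extending a basis of L the linear parts become
   block triangular integral matrices, and the basis can be chosen so that their
   entries are bounded in terms of n: lattices spanned by the orbit of a shortest
   vector are handled by Cramer's rule, and off-diagonal blocks are cocycles
   killed by the order of the group. If moreover the origin is the barycentre of
   an orbit of coset representatives, the translation parts have bounded
   denominators. Hence (Gamma, N) is encoded, up to an affine change of
   coordinates, by one of finitely many finite sets of matrices and vectors. *)
Require Import Defs.
From mathcomp Require Import all_boot all_order all_algebra perm generic_quotient.
From mathcomp Require Import all_classical all_reals all_analysis.
From mathcomp Require Import ring lra zify.

Set Implicit Arguments.
Unset Strict Implicit.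
Unset Printing Implicit Defensive.

Import Order.TTheory GRing.Theory Num.Theory.
Import numFieldNormedType.Exports.
Local Open Scope classical_set_scope.
Local Open Scope ring_scope.

(** * Pigeonhole principles and integral vectors *)

(** The hypothesis on the quotient enters through one fact: in a space group, an element of finite
    order that commutes with a subgroup of finite index is trivial. Applied in Gamma / N to the
    image of T, it yields both the purity of L and the description of N by L, so N adds to the code
    only the rank of L. The obstacle is uniformity: infinitely many lattices T occur, and the change
    of basis that makes the linear parts small must also preserve L. Hence the two diagonal blocks
    are bounded separately, and only block triangular unimodular changes of basis are allowed. The
    bound on each block is a Jordan-Zassenhaus statement, proved by induction on the rank: the pure
    sublattice spanned by the orbit of a shortest vector is split off, and the quotient has smaller
    rank. Compactness of the orthogonal group is replaced by a pigeonhole argument on boxes of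
    matrix entries, which also bounds the number of linear parts. *)

Lemma pigeonhole_nat (T : finType) (f : nat -> T) :
  exists i j, [/\ (i < j)%N, (j <= #|T|)%N & f i = f j].
Proof.
have [/injectiveP finj|] := boolP (injectiveb (fun i : 'I_#|T|.+1 => f i)).
  by have := leq_card _ finj; rewrite card_ord ltnn.
case/injectivePn => i [j nij fij].
case: (ltngtP i j) => ij.
- by exists i, j; split=> //; rewrite -ltnS.
- by exists j, i; split=> //; rewrite -ltnS.
- by move/val_inj: ij nij => ->; rewrite eqxx.
Qed.

Lemma ex_minimal (P : nat -> Prop) (k0 : nat) : P k0 ->
  exists k, P k /\ forall j, P j -> (k <= j)%N.
Proof.
move=> Pk0; have ex : exists k, `[< P k >] by exists k0; apply/asboolP.
exists (ex_minn ex); case: ex_minnP => k /asboolP Pk kmin; split=> // j Pj.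
by apply: kmin; apply/asboolP.
Qed.

Lemma ex_maximal (P : nat -> Prop) (k0 b : nat) : P k0 ->
  (forall k, P k -> (k <= b)%N) ->
  exists k, P k /\ forall j, P j -> (j <= k)%N.
Proof.
move=> Pk0 Pb; have [|k [[Pk kb] kmin]] :=
  @ex_minimal (fun k => P (b - k)%N /\ (k <= b)%N) (b - k0).
  by rewrite subKn ?leq_subr//; exact: Pb.
exists (b - k)%N; split=> // j Pj; have jb := Pb _ Pj.
have := kmin (b - j)%N; rewrite subKn// leq_subr => /(_ (conj Pj isT)).
lia.
Qed.

Lemma uniform_bound (R : realDomainType) (S : finType) (P : S -> R -> Prop) :
  (forall s c c', P s c -> c <= c' -> P s c') ->
  (forall s, exists c, P s c) -> exists2 c, 0 <= c & forall s, P s c.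
Proof.
move=> Pmono /choice[c Pc]; exists (\sum_s `|c s|) => [|s].
  exact: sumr_ge0.
apply: Pmono (Pc s) _; rewrite (bigD1 s)//=.
by rewrite (le_trans (ler_norm _))// lerDl sumr_ge0.
Qed.

Section Boxes.
Context {R : realType}.
Implicit Types x y : R.

Definition box (K : nat) x : 'I_K.+1 := inord `|Num.floor (x * K.+1%:R)|%N.

Lemma box_eq K x y : 0 <= x < 1 -> 0 <= y < 1 -> box K x = box K y ->
  `|x - y| < K.+1%:R^-1.
Proof.
have K0 : 0 < K.+1%:R :> R by rewrite ltr0n.
have H (z : R) : 0 <= z < 1 ->
  0 <= Num.floor (z * K.+1%:R) /\ (`|Num.floor (z * K.+1%:R)| < K.+1)%N.
  move=> /andP[z0 z1].
  have f0 : 0 <= Num.floor (z * K.+1%:R) by rewrite Num.Theory.floor_ge0 mulr_ge0// ltW.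
  split=> //; rewrite -ltz_nat gez0_abs// floor_lt_int.
  by rewrite -[ltRHS]mul1r ltr_pM2r.
move=> /H[x0 xK] /H[y0 yK] /(congr1 val); rewrite /= !inordK// => xy.
have {xy}xy : Num.floor (x * K.+1%:R) = Num.floor (y * K.+1%:R).
  by rewrite -(gez0_abs x0) -(gez0_abs y0) xy.
have : `|x * K.+1%:R - y * K.+1%:R| < 1.
  have /andP[] := floor_itv (x * K.+1%:R); have /andP[] := floor_itv (y * K.+1%:R).
  rewrite -xy intrD => a1 a2 a3 a4; rewrite ltr_norml; apply/andP; split; lra.
rewrite -mulrBl normrM [X in _ * X]gtr0_norm// => h.
by rewrite -[ltRHS]mul1r ltr_pdivlMr.
Qed.

End Boxes.

Notation intmx := (mxOver Num.int).

Section Integral.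
Context {R : realType}.

Definition floormx m n (A : 'M[R]_(m, n)) : 'M[R]_(m, n) :=
  map_mx (fun x => (Num.floor x)%:~R) A.

Lemma floormx_int m n (A : 'M[R]_(m, n)) : floormx A \is a intmx.
Proof. by apply/mxOverP => i j; rewrite mxE intr_int. Qed.

Lemma floormx_frac m n (A : 'M[R]_(m, n)) i j : 0 <= (A - floormx A) i j < 1.
Proof.
rewrite !mxE; have /andP[] := floor_itv (A i j).
by rewrite intrD => a b; apply/andP; split; lra.
Qed.

Lemma intmxB m n (A B : 'M[R]_(m, n)) :
  A \is a intmx -> B \is a intmx -> A - B \is a intmx.
Proof. by move=> /mxOverP Ai /mxOverP Bi; apply/mxOverP => i j; rewrite !mxE rpredB. Qed.

Lemma intmxD m n (A B : 'M[R]_(m, n)) :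
  A \is a intmx -> B \is a intmx -> A + B \is a intmx.
Proof. by move=> /mxOverP Ai /mxOverP Bi; apply/mxOverP => i j; rewrite !mxE rpredD. Qed.

Lemma intmx1 n : (1%:M : 'M[R]_n) \is a intmx.
Proof. by apply/mxOverP => i j; rewrite mxE rpred_nat. Qed.

Lemma intmx_det n (A : 'M[R]_n) : A \is a intmx -> \det A \is a Num.int.
Proof.
move=> /mxOverP Ai; rewrite rpred_sum// => s _.
by rewrite rpredM ?rpred_sign// rpred_prod.
Qed.

Lemma intmx_natZ m n (A : 'M[R]_(m, n)) k : A \is a intmx -> k%:R *: A \is a intmx.
Proof. by move=> /mxOverP Ai; apply/mxOverP => i j; rewrite mxE rpredM// rpred_nat. Qed.

Lemma int_norm_lt1 (x : R) : x \is a Num.int -> `|x| < 1 -> x = 0.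
Proof. by move=> xi x1; apply/eqP; rewrite -[_ == 0]negbK;
  apply/negP => /(norm_intr_ge1 xi); rewrite leNgt x1. Qed.

End Integral.

Section Dirichlet.
Context {R : realType} {n : nat}.
Implicit Types (T : set 'rV[R]_n) (E : 'M[R]_n).

Definition zmod_set T := T 0 /\ forall x y, T x -> T y -> T (x - y).

Lemma zmod_setN T x : zmod_set T -> T x -> T (- x).
Proof. by case=> T0 TB Tx; rewrite -[- x]add0r; exact: TB. Qed.

Lemma zmod_setD T x y : zmod_set T -> T x -> T y -> T (x + y).
Proof. by move=> zT Tx Ty; rewrite -[y]opprK; apply: zT.2 => //; exact: zmod_setN. Qed.

Lemma zmod_setMn T x k : zmod_set T -> T x -> T (x *+ k).
Proof.
move=> zT Tx; elim: k => [|k ih]; first by rewrite mulr0n; exact: zT.1.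
by rewrite mulrS; exact: zmod_setD.
Qed.

Lemma zmod_setZ T x a : zmod_set T -> T x -> a \is a Num.int -> T (a *: x).
Proof.
move=> zT Tx /intrP[z ->]; rewrite scaler_int.
case: z => k; first exact: zmod_setMn.
by rewrite NegzE mulrNz; apply: zmod_setN => //; exact: zmod_setMn.
Qed.

Lemma zmod_set_sum T (I : Type) (r : seq I) (P : pred I) (F : I -> 'rV[R]_n) :
  zmod_set T -> (forall i, P i -> T (F i)) -> T (\sum_(i <- r | P i) F i).
Proof. by move=> zT TF; apply: big_ind => //;
  [exact: zT.1|move=> ? ? *; exact: zmod_setD]. Qed.

Lemma zmod_set_mulmx T m (A : 'rV[R]_m) (E : 'M[R]_(m, n)) : zmod_set T ->
  (forall i, T (row i E)) -> A \is a intmx -> T (A *m E).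
Proof.
move=> zT TE /mxOverP Ai; rewrite mulmx_sum_row.
by apply: zmod_set_sum => // i _; exact: zmod_setZ.
Qed.

(** Among the multiples of [x] by 0, ..., (K+1)^n, two have fractional parts (in [E]-coordinates) in
    the same box of side 1/(K+1). Their difference lies in [T] and is too short to be nonzero, so a
    multiple of [x] by some k <= (K+1)^n is integral, and k divides the factorial. *)
Lemma dirichlet T E K x : zmod_set T -> E \in unitmx -> (forall i, T (row i E)) ->
  (forall y : 'rV_n, (forall j, `|y 0 j| < K.+1%:R^-1) -> T (y *m E) -> y = 0) ->
  T x -> ((K.+1 ^ n)`!)%:R *: (x *m invmx E) \is a intmx.
Proof.
move=> zT uE TE sep Tx; set y := x *m invmx E.
pose fr k := y *+ k - floormx (y *+ k).
have [i [j [ij jK /matrixP eqb]]] := pigeonhole_nat (fun k => map_mx (box K) (fr k)).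
rewrite card_mx card_ord mul1n in jK.
have frT k : T (fr k *m E).
  rewrite /fr mulmxBl -scaler_nat -scalemxAl; apply: zT.2; last by apply:
    zmod_set_mulmx => //; exact: floormx_int.
  by rewrite scaler_nat; apply: (zmod_setMn k zT); rewrite /y mulmxKV.
have : fr j - fr i = 0.
  apply: sep; last by rewrite mulmxBl; apply: zT.2.
  move=> l; have -> : (fr j - fr i) 0 l = fr j 0 l - fr i 0 l by rewrite !mxE.
  rewrite distrC; apply: box_eq; try exact: floormx_frac.
  by have := eqb 0 l; rewrite mxE [RHS]mxE.
move/eqP; rewrite subr_eq0 => /eqP eqf.
have yk : y *+ (j - i) \is a intmx.
  have -> : y *+ (j - i) = floormx (y *+ j) - floormx (y *+ i).
    rewrite mulrnBr ?(ltnW ij)//; apply/eqP.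
    by rewrite subr_eq -addrA [eqbRHS]addrC -subr_eq [eqbRHS]addrC; apply/eqP.
  by rewrite intmxB// floormx_int.
have /dvdnP[q ->] : (j - i %| (K.+1 ^ n)`!)%N.
  by rewrite dvdn_fact// subn_gt0 ij/= (leq_trans (leq_subr _ _)).
by rewrite natrM -scalerA (scaler_nat (j - i)) intmx_natZ.
Qed.

End Dirichlet.

(** * Bases of discrete subgroups *)

Section AdaptedBasis.
Context {R : realType} {n : nat}.
Implicit Types (T L : set 'rV[R]_n) (E : 'M[R]_n).

Definition discrete_set T :=
  exists2 rho, 0 < rho & forall x, T x -> (forall j, `|x 0 j| < rho) -> x = 0.

Lemma discrete_sep T E : discrete_set T -> E \in unitmx ->
  exists K : nat, forall y : 'rV_n, (forall j, `|y 0 j| < K.+1%:R^-1) ->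
    T (y *m E) -> y = 0.
Proof.
move=> [rho rho0 Trho] uE; pose C := \sum_i \sum_j `|E i j|.
have C0 : 0 <= C by rewrite !sumr_ge0// => i _; rewrite sumr_ge0.
exists (Num.bound (C / rho)) => y yK TyE.
have := archi_boundP (divr_ge0 C0 (ltW rho0)); set K := Num.bound _ => CK.
have K0 : 0 < K.+1%:R :> R by rewrite ltr0n.
suff : y *m E = 0 by move=> /(congr1 (mulmx^~ (invmx E))); rewrite mulmxK// mul0mx.
apply: Trho => // l; rewrite mxE.
apply: (@le_lt_trans _ _ (K.+1%:R^-1 * C)); last first.
  rewrite mulrC ltr_pdivrMr// mulrC -ltr_pdivrMr//.
  by rewrite (lt_le_trans CK)// ler_nat.
rewrite mulr_sumr (le_trans (ler_norm_sum _ _ _))// ler_sum// => i _.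
rewrite normrM; apply: ler_pM => //; first exact: ltW.
by rewrite (bigD1 l)//= lerDl sumr_ge0.
Qed.

Lemma det_replace_row E (j : 'I_n) (x : 'rV_n) :
  \det (\matrix_i (if i == j then x else row i E)) = (x *m \adj E) 0 j.
Proof.
rewrite (expand_det_row _ j) mxE; apply: eq_bigr => k _.
rewrite !mxE eqxx; congr (_ * _); rewrite /cofactor; congr (_ * \det _).
apply/matrixP => a b; rewrite !mxE eq_sym (negbTE (neq_lift _ _)).
by rewrite mxE.
Qed.

Lemma det_replace_coord E (j : 'I_n) (x : 'rV_n) : E \in unitmx ->
  \det (\matrix_i (if i == j then x else row i E)) = (x *m invmx E) 0 j * \det E.
Proof.
move=> uE; rewrite det_replace_row /invmx uE -scalemxAr [in RHS]mxE mulrAC mulVf ?mul1r//.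
by move: uE; rewrite unitmxE unitfE.
Qed.

(* Among the bases of the ambient space consisting of vectors of T, the first r
   of them in L, one with r maximal and then |det| minimal is a basis of T:
   otherwise replacing a basis vector by a fractional combination would
   decrease the determinant. *)
Lemma adapted_basis T L E0 : zmod_set T -> discrete_set T ->
  E0 \in unitmx -> (forall i, T (row i E0)) ->
  zmod_set L -> L `<=` T ->
  (forall x k, T x -> (0 < k)%N -> L (x *+ k) -> L x) ->
  exists (r : nat) E, [/\ (r <= n)%N, E \in unitmx,
    (forall x, T x <-> x *m invmx E \is a intmx) &
    (forall x, L x <-> x *m invmx E \is a intmx /\
       forall j : 'I_n, (r <= j)%N -> (x *m invmx E) 0 j = 0)].
Proof.
move=> zT dT uE0 TE0 zL LT Lpure.
pose good r E := [/\ E \in unitmx, (forall i, T (row i E)) &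
  forall i : 'I_n, (i < r)%N -> L (row i E)].
have [||r [[rn [E1 gE1]] rmax]] :=
  @ex_maximal (fun r => (r <= n)%N /\ exists E, good r E) 0 n.
- by split=> //; exists E0; split.
- by move=> k [].
have [K0 sep0] := discrete_sep dT uE0.
(* By [dirichlet], [N] clears the denominators of all of [T] in the basis [E0]. So [dd E], a fixed
   multiple of the determinant, is an integer for good [E], and its absolute value attains a
   minimum. *)
pose N := ((K0.+1 ^ n)`!)%:R : R.
have N0 : N != 0 by rewrite /N pnatr_eq0 -lt0n fact_gt0.
pose dd E := \det (N *: (E *m invmx E0)).
have ddE E : dd E = N ^+ n * \det E * \det (invmx E0) by rewrite /dd detZ det_mulmx mulrA.
have ddint E : good r E -> dd E \is a Num.int.
  move=> [_ TE _]; apply: intmx_det; apply/mxOverP => i j.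
  have := dirichlet zT uE0 TE0 sep0 (TE i) => /mxOverP/(_ 0 j).
  by rewrite [in X in X -> _]mxE -row_mul [in X in X -> _]mxE [in X in _ -> X]mxE.
have dd0 E : E \in unitmx -> dd E != 0.
  move=> uE; rewrite ddE !mulf_neq0 ?expf_neq0//.
    by rewrite -unitfE -unitmxE.
  by rewrite -unitfE -unitmxE unitmx_inv.
have [|k [kex kmin]] := @ex_minimal (fun k => exists E, good r E /\ `|dd E| = k%:R)
    (Num.truncn `|dd E1|).
  by exists E1; split=> //; rewrite truncnK// natr_norm_int// ddint.
have [E [gE kE]] := kex; have [uE TE LE] := gE.
pose y (x : 'rV_n) : 'rV_n := x *m invmx E.
(* Replacing row j by [x] multiplies the determinant by the j-th coordinate of [x]; a nonzero
   coordinate below 1 in absolute value would contradict minimality. *)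
have coord1 (x : 'rV_n) (j : 'I_n) : T x -> ((j < r)%N -> L x) -> `|y x 0 j| < 1 ->
  y x 0 j = 0.
  move=> Tx Lx; apply: contraPeq => yn0 y1.
  pose E' := \matrix_i (if i == j then x else row i E).
  have detE' : \det E' = y x 0 j * \det E by exact: det_replace_coord.
  have uE' : E' \in unitmx.
    by rewrite unitmxE detE' unitrM !unitfE yn0/= -unitfE -unitmxE.
  have gE' : good r E'.
    split=> // i; rewrite rowK; first by case: eqP.
    by move=> ir; case: eqP => [ij|_]; [apply: Lx; rewrite -ij|exact: LE].
  have [k' k'E] : exists k', `|dd E'| = k'%:R.
    by exists (Num.truncn `|dd E'|); rewrite truncnK// natr_norm_int// ddint.
  have := kmin k' (ex_intro _ E' (conj gE' k'E)); rewrite leqNgt => /negP; apply.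
  have ddE' : dd E' = y x 0 j * dd E by rewrite !ddE detE'; ring.
  rewrite -(ltr_nat R) -kE -k'E ddE' normrM -[ltRHS]mul1r ltr_pM2r//.
  by rewrite normr_gt0 dd0.
have ydiff x a i j : y (x - a *: row i E) 0 j = y x 0 j - a * (i == j)%:R.
  by rewrite /y mulmxBl -scalemxAl -row_mul mulmxV// !mxE.
have intcoord x (j : 'I_n) : T x -> ((j < r)%N -> L x) -> y x 0 j \is a Num.int.
  move=> Tx Lx; pose a := (Num.floor (y x 0 j))%:~R : R.
  have aint : a \is a Num.int by rewrite intr_int.
  have := @coord1 (x - a *: row j E) j; rewrite ydiff eqxx mulr1.
  have /andP[a1 a2] := floor_itv (y x 0 j); rewrite intrD in a2.
  move=> H; have /eqP : y x 0 j - a = 0.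
    apply: H; first by apply: zT.2 => //; exact: zmod_setZ.
      by move=> jr; apply: zL.2; [exact: Lx|apply: zmod_setZ => //; exact: LE].
    by rewrite ger0_norm /a; lra.
  by rewrite subr_eq0 => /eqP ->.
(* Otherwise [x] could replace row j and be swapped into position r, giving r + 1 basis vectors in
   [L]. *)
have vanish x (j : 'I_n) : L x -> (r <= j)%N -> y x 0 j = 0.
  move=> Lx rj; have rn' : (r < n)%N by exact: leq_ltn_trans rj _.
  apply/eqP; rewrite -[_ == 0]negbK; apply/negP => yn0.
  pose E' := \matrix_i (if i == j then x else row i E).
  have uE' : E' \in unitmx.
    by rewrite unitmxE det_replace_coord// unitrM !unitfE yn0/= -unitfE -unitmxE.
  have := rmax r.+1; rewrite ltnn rn' => /(_ _)/wrap[]//.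
  split=> //; exists (xrow j (Ordinal rn') E').
  have xr i : row i (xrow j (Ordinal rn') E') = row (tperm j (Ordinal rn') i) E'.
    by apply/rowP => l; rewrite !mxE.
  split; first by rewrite xrowE unitmx_mul unitmx_perm.
    by move=> i; rewrite xr rowK; case: eqP => // _; exact: LT.
  move=> i ir; rewrite xr; case: tpermP => [ij|ij|/eqP ij /eqP ir'].
  - rewrite rowK; case: eqP => // -[]; apply/val_inj => /=.
    by apply/eqP; rewrite eqn_leq rj/= -ij -ltnS.
  - by rewrite rowK eqxx.
  - rewrite rowK (negbTE ij); apply: LE; rewrite ltn_neqAle -ltnS ir andbT.
    by apply: contraNneq ir' => ir'; apply/eqP/val_inj.
have yE x : x = \sum_i y x 0 i *: row i E by rewrite -mulmx_sum_row /y mulmxKV.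
have [K1 sep1] := discrete_sep dT uE.
have rat x := dirichlet (x := x) zT uE TE sep1.
have int_ge x (j : 'I_n) : T x -> (r <= j)%N -> y x 0 j \is a Num.int.
  by move=> Tx rj; apply: intcoord => //; rewrite ltnNge rj.
have intT x : T x -> y x \is a intmx.
  move=> Tx; apply/mxOverP => i0 j; rewrite ord1.
  have [jr|] := ltnP j r; last exact: int_ge.
  (* For j < r, [intcoord] needs a vector of [L]. Removing the coordinates from r on, already
     integral, keeps [x'] in [T]; a multiple of [x'] is an integral combination of vectors of [L],
     so purity puts [x'] in [L]. *)
  pose x' := \sum_(i < n | (i < r)%N) y x 0 i *: row i E.
  have xx' : x' = x - \sum_(i < n | ~~ (i < r)%N) y x 0 i *: row i E.
    by rewrite {1}[x]yE (bigID (fun i : 'I_n => (i < r)%N))/= addrK.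
  have Tx' : T x'.
    rewrite xx'; apply: zT.2 => //; apply: zmod_set_sum => // i ir.
    by apply: zmod_setZ => //; apply: int_ge => //; rewrite leqNgt.
  have Lx' : L x'.
    apply: (@Lpure _ ((K1.+1 ^ n)`!)) => //; first by rewrite fact_gt0.
    rewrite -scaler_nat scaler_sumr; apply: zmod_set_sum => // i ir.
    rewrite scalerA; apply: zmod_setZ => //; first exact: LE.
    by have /mxOverP/(_ 0 i) := rat x Tx; rewrite mxE.
  have yx' : y x' 0 j = y x 0 j.
    rewrite /y {1}/x' mulmx_suml summxE (bigD1 j)//= big1 ?addr0.
      by rewrite -scalemxAl -row_mul mulmxV// !mxE eqxx mulr1.
    by move=> i /andP[_ ij]; rewrite -scalemxAl -row_mul mulmxV// !mxE (negbTE ij) mulr0.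
  by rewrite -yx'; exact: intcoord.
exists r, E; split=> // x; split.
- exact: intT.
- by move=> yi; rewrite -[x](mulmxKV uE); exact: zmod_set_mulmx.
- by move=> Lx; split; [apply: intT; exact: LT|move=> j; exact: vanish].
- move=> [yi y0]; rewrite [x]yE (bigID (fun i : 'I_n => (i < r)%N))/=.
  rewrite [X in _ + X]big1 ?addr0 => [|i]; last first.
    by rewrite -leqNgt => ir; rewrite /y y0// scale0r.
  apply: zmod_set_sum => // i ir; apply: zmod_setZ zL (LE _ ir) _.
  exact: (mxOverP yi).
Qed.

End AdaptedBasis.

(** * The Frobenius norm *)

Section FrobeniusNorm.
Context {R : realType}.

(** Lagrange's identity: twice the difference of the two sides is a sum of squares. *)
Lemma cauchy_schwarz (I : finType) (a b : I -> R) :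
  (\sum_i a i * b i) ^+ 2 <= (\sum_i a i ^+ 2) * (\sum_i b i ^+ 2).
Proof.
have : 0 <= \sum_i \sum_j (a i * b j - a j * b i) ^+ 2.
  by rewrite sumr_ge0// => i _; rewrite sumr_ge0// => j _; exact: sqr_ge0.
have -> : \sum_i \sum_j (a i * b j - a j * b i) ^+ 2 =
  ((\sum_i a i ^+ 2) * (\sum_i b i ^+ 2) - (\sum_i a i * b i) ^+ 2) *+ 2.
  have -> : \sum_i \sum_j (a i * b j - a j * b i) ^+ 2 =
    \sum_i \sum_j (a i ^+ 2 * b j ^+ 2) + \sum_i \sum_j (b i ^+ 2 * a j ^+ 2)
    - (\sum_i \sum_j (a i * b i) * (a j * b j)) *+ 2.
    rewrite -big_split -sumrMnl -sumrB; apply: eq_bigr => i _ /=.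
    rewrite -big_split -sumrMnl -sumrB; apply: eq_bigr => j _ /=.
    by rewrite mulr2n; ring.
  by rewrite expr2 -!big_distrlr/= mulr2n; ring.
by rewrite pmulrn_lge0// subr_ge0.
Qed.

Definition sqn m n (A : 'M[R]_(m, n)) := \sum_i \sum_j A i j ^+ 2.

Definition fnorm m n (A : 'M[R]_(m, n)) := Num.sqrt (sqn A).

Lemma sqn_ge0 m n (A : 'M[R]_(m, n)) : 0 <= sqn A.
Proof. by rewrite sumr_ge0// => i _; rewrite sumr_ge0// => j _; exact: sqr_ge0. Qed.

Lemma sqn0 m n : sqn (0 : 'M[R]_(m, n)) = 0.
Proof. by rewrite /sqn big1// => i _; rewrite big1// => j _; rewrite mxE expr0n. Qed.

Lemma sqn_eq0 m n (A : 'M[R]_(m, n)) : sqn A = 0 -> A = 0.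
Proof.
move=> /eqP; rewrite psumr_eq0 => [/allP A0|i _]; last first.
  by rewrite sumr_ge0// => j _; exact: sqr_ge0.
apply/matrixP => i j; rewrite mxE; apply/eqP.
have /implyP/(_ isT) := A0 i (mem_index_enum _).
rewrite psumr_eq0 => [/allP/(_ j (mem_index_enum _))|k _]; last exact: sqr_ge0.
by rewrite sqrf_eq0.
Qed.

Lemma sqnZ m n a (A : 'M[R]_(m, n)) : sqn (a *: A) = a ^+ 2 * sqn A.
Proof.
rewrite mulr_sumr; apply: eq_bigr => i _; rewrite mulr_sumr; apply: eq_bigr => j _.
by rewrite mxE exprMn.
Qed.

Lemma sqn_trace m n (A : 'M[R]_(m, n)) : sqn A = \tr (A *m A^T).
Proof.
apply: eq_bigr => i _; rewrite mxE; apply: eq_bigr => j _.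
by rewrite mxE expr2.
Qed.

Lemma sqn_mulmx_orth m n p (A : 'M[R]_(m, n)) (P : 'M[R]_(n, p)) :
  P *m P^T = 1%:M -> sqn (A *m P) = sqn A.
Proof. by move=> PP; rewrite !sqn_trace trmx_mul mulmxA -(mulmxA A) PP mulmx1. Qed.

Lemma sqn_orth_mulmx m n p (A : 'M[R]_(m, n)) (P : 'M[R]_(p, m)) :
  P^T *m P = 1%:M -> sqn (P *m A) = sqn A.
Proof. by move=> PP; rewrite !sqn_trace trmx_mul mxtrace_mulC -!mulmxA (mulmxA _ P) PP
  mul1mx mxtrace_mulC. Qed.

Lemma sqnM m n p (A : 'M[R]_(m, n)) (B : 'M[R]_(n, p)) : sqn (A *m B) <= sqn A * sqn B.
Proof.
have -> : sqn B = \sum_j \sum_i B i j ^+ 2 by rewrite /sqn exchange_big.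
rewrite /sqn big_distrlr/= ler_sum// => i _; rewrite ler_sum// => j _.
by rewrite mxE cauchy_schwarz.
Qed.

Lemma sqr_sum_le (I : finType) (a : I -> R) :
  (\sum_i a i) ^+ 2 <= #|I|%:R * \sum_i a i ^+ 2.
Proof.
have := cauchy_schwarz (fun=> 1) a.
rewrite (eq_bigr a) => [|i _]; last by rewrite mul1r.
by rewrite expr1n sumr_const.
Qed.

Lemma sqn_sum_le m n (I : finType) (F : I -> 'M[R]_(m, n)) :
  sqn (\sum_i F i) <= #|I|%:R * \sum_i sqn (F i).
Proof.
have -> : \sum_i sqn (F i) = \sum_k \sum_l \sum_i F i k l ^+ 2.
  by rewrite exchange_big; apply: eq_bigr => k _; rewrite exchange_big.
rewrite /sqn mulr_sumr ler_sum// => k _; rewrite mulr_sumr ler_sum// => l _.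
by rewrite summxE sqr_sum_le.
Qed.

Lemma sqn_sqr m n (A : 'M[R]_(m, n)) : sqn A = fnorm A ^+ 2.
Proof. by rewrite sqr_sqrtr// sqn_ge0. Qed.

Lemma fnorm_ge0 m n (A : 'M[R]_(m, n)) : 0 <= fnorm A.
Proof. exact: sqrtr_ge0. Qed.

Lemma fnorm_eq0 m n (A : 'M[R]_(m, n)) : fnorm A = 0 -> A = 0.
Proof. by move=> A0; apply: sqn_eq0; rewrite sqn_sqr A0 expr0n. Qed.

Lemma fnorm0 m n : fnorm (0 : 'M[R]_(m, n)) = 0.
Proof. by rewrite /fnorm sqn0 sqrtr0. Qed.

Lemma fnormZ m n a (A : 'M[R]_(m, n)) : fnorm (a *: A) = `|a| * fnorm A.
Proof. by rewrite /fnorm sqnZ sqrtrM ?sqr_ge0// sqrtr_sqr. Qed.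

Lemma fnormN m n (A : 'M[R]_(m, n)) : fnorm (- A) = fnorm A.
Proof. by rewrite -scaleN1r fnormZ normrN1 mul1r. Qed.

Lemma fnormB m n (A B : 'M[R]_(m, n)) : fnorm (A - B) = fnorm (B - A).
Proof. by rewrite -fnormN opprB. Qed.

Lemma fnormM m n p (A : 'M[R]_(m, n)) (B : 'M[R]_(n, p)) :
  fnorm (A *m B) <= fnorm A * fnorm B.
Proof. by rewrite /fnorm -sqrtrM ?sqn_ge0// ler_wsqrtr// sqnM. Qed.

Lemma fnorm_mulmx_orth m n p (A : 'M[R]_(m, n)) (P : 'M[R]_(n, p)) :
  P *m P^T = 1%:M -> fnorm (A *m P) = fnorm A.
Proof. by move=> PP; rewrite /fnorm sqn_mulmx_orth. Qed.

Lemma fnorm_orth_mulmx m n p (A : 'M[R]_(m, n)) (P : 'M[R]_(p, m)) :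
  P^T *m P = 1%:M -> fnorm (P *m A) = fnorm A.
Proof. by move=> PP; rewrite /fnorm sqn_orth_mulmx. Qed.

Lemma sqnD m n (A B : 'M[R]_(m, n)) :
  sqn (A + B) = sqn A + sqn B + (\sum_i \sum_j A i j * B i j) *+ 2.
Proof.
rewrite -sumrMnl -!big_split; apply: eq_bigr => i _ /=.
rewrite -sumrMnl -!big_split; apply: eq_bigr => j _ /=.
by rewrite mxE mulr2n; ring.
Qed.

Lemma fnormD m n (A B : 'M[R]_(m, n)) : fnorm (A + B) <= fnorm A + fnorm B.
Proof.
rewrite -(@ler_pXn2r _ 2)// ?nnegrE ?addr_ge0 ?fnorm_ge0//.
rewrite -sqn_sqr sqnD sqrrD addrAC -!sqn_sqr lerD2r lerD2l lerMn2r/=.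
apply: le_trans (ler_norm _) _.
rewrite -(@ler_pXn2r _ 2)// ?nnegrE ?mulr_ge0 ?fnorm_ge0// real_normK ?num_real//.
rewrite exprMn -!sqn_sqr /sqn !pair_big/=.
exact: cauchy_schwarz.
Qed.

Lemma fnormD_ge m n (A B : 'M[R]_(m, n)) : fnorm A - fnorm B <= fnorm (A + B).
Proof. by rewrite lerBlDr -[in leLHS](addrK B A) -(fnormN B) fnormD. Qed.

Lemma entry_le_fnorm m n (A : 'M[R]_(m, n)) i j : `|A i j| <= fnorm A.
Proof.
rewrite -sqrtr_sqr ler_wsqrtr// /sqn (bigD1 i)//= (bigD1 j)//= -addrA lerDl addr_ge0//.
  by rewrite sumr_ge0// => k _; exact: sqr_ge0.
by rewrite sumr_ge0// => k _; rewrite sumr_ge0// => l _; exact: sqr_ge0.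
Qed.

Lemma fnorm_le_entry m n (A : 'M[R]_(m, n)) c : 0 <= c ->
  (forall i j, `|A i j| <= c) -> fnorm A <= (m * n)%:R * c.
Proof.
move=> c0 Ac; have -> : A = \sum_(p : 'I_m * 'I_n) A p.1 p.2 *: delta_mx p.1 p.2.
  by rewrite {1}[A]matrix_sum_delta pair_big.
have -> : (m * n)%:R * c = \sum_(p : 'I_m * 'I_n) c.
  by rewrite sumr_const card_prod !card_ord mulr_natl.
elim/big_ind2: _ => [|a b a' b' h h'|[i j] _]; first by rewrite fnorm0.
  by rewrite (le_trans (fnormD _ _))// lerD.
rewrite fnormZ; apply: le_trans (Ac i j).
suff -> : fnorm (delta_mx i j : 'M[R]_(m, n)) = 1 by rewrite mulr1.
rewrite /fnorm /sqn (bigD1 i)//= (bigD1 j)//= !big1 ?addr0 => [||k kj].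
- by rewrite mxE !eqxx expr1n sqrtr1.
- by move=> k ki; rewrite big1// => l _; rewrite mxE (negbTE ki) expr0n.
- by rewrite mxE (negbTE kj) andbF expr0n.
Qed.

(** If X A = 0, then X (A - 1) = -X, and submultiplicativity of the norm forces X = 0. *)
Lemma unitmx_near1 n (A : 'M[R]_n) : fnorm (A - 1%:M) < 1 -> A \in unitmx.
Proof.
move=> A1; rewrite -row_free_unit -kermx_eq0; apply/eqP.
set X := kermx A; have XA : X *m A = 0 by exact: mulmx_ker.
apply: fnorm_eq0; have := fnormM X (A - 1%:M).
rewrite mulmxBr XA mulmx1 sub0r fnormN => H; apply/eqP.
rewrite eq_le fnorm_ge0 andbT leNgt; apply/negP => X0.
by move: H; apply/negP; rewrite -ltNge -[ltRHS]mulr1 ltr_pM2l.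
Qed.

End FrobeniusNorm.

(** * Finite groups of integral matrices *)

Section BoundedMatrices.
Context {R : realType}.

Lemma mulmx1_invmx n (A B : 'M[R]_n) : A *m B = 1%:M -> B = invmx A.
Proof. by move=> AB; have [uA _] := mulmx1_unit AB;
  rewrite -[LHS](mulKmx uA) AB mulmx1. Qed.

Definition mx_bounded m n (c : R) (A : 'M[R]_(m, n)) := forall i j, `|A i j| <= c.

Lemma mx_boundedW m n c c' (A : 'M[R]_(m, n)) :
  c <= c' -> mx_bounded c A -> mx_bounded c' A.
Proof. by move=> cc Ac i j; exact: le_trans cc. Qed.

Lemma mx_boundedM m n p a b (A : 'M[R]_(m, n)) (B : 'M[R]_(n, p)) :
  mx_bounded a A -> mx_bounded b B -> mx_bounded (n%:R * (a * b)) (A *m B).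
Proof.
move=> Aa Bb i j; rewrite mxE (le_trans (ler_norm_sum _ _ _))//.
apply: (@le_trans _ _ (\sum_(k < n) a * b)); last first.
  by rewrite sumr_const card_ord mulr_natl.
by apply: ler_sum => k _; rewrite normrM ler_pM.
Qed.

Lemma mx_bounded_exists m n (A : 'M[R]_(m, n)) : exists2 c, 0 <= c & mx_bounded c A.
Proof.
exists (\sum_i \sum_j `|A i j|) => [|i j].
  by rewrite sumr_ge0// => i _; rewrite sumr_ge0.
rewrite (bigD1 i)//= (bigD1 j)//= -addrA lerDl addr_ge0// sumr_ge0// => k _.
by rewrite sumr_ge0.
Qed.

Lemma mx_bounded_block m1 m2 n1 n2 c (A : 'M[R]_(m1, n1)) (B : 'M[R]_(m1, n2))
    (C : 'M[R]_(m2, n1)) (D : 'M[R]_(m2, n2)) :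
  mx_bounded c A -> mx_bounded c B -> mx_bounded c C -> mx_bounded c D ->
  mx_bounded c (block_mx A B C D).
Proof.
move=> Ac Bc Cc Dc i j; rewrite -[i]splitK -[j]splitK.
by case: (fintype.split i) => k; case: (fintype.split j) => l /=;
  rewrite ?block_mxEul ?block_mxEur ?block_mxEdl ?block_mxEdr.
Qed.

End BoundedMatrices.

Section Actions.
Context {R : realType} {I : finType} (mul : I -> I -> I) (inv : I -> I).

(* An indexed finite group of integral matrices: unlike the set of its values,
   the index type survives passing to the diagonal blocks. *)
Definition mx_action n (rho : I -> 'M[R]_n) :=
  [/\ forall i j, rho (mul i j) = rho i *m rho j, forall i, injective (mul i),
      forall i, rho i *m rho (inv i) = 1%:M & forall i, rho i \is a intmx].

Lemma mx_action_unit n (rho : I -> 'M[R]_n) i : mx_action rho -> rho i \in unitmx.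
Proof. by case=> _ _ rV _; have /mulmx1_unit[] := rV i. Qed.

Lemma mx_action_conj n (rho : I -> 'M[R]_n) (P P' : 'M[R]_n) : mx_action rho ->
  P \is a intmx -> P' \is a intmx -> P *m P' = 1%:M ->
  mx_action (fun i => P *m rho i *m P').
Proof.
move=> [rM mI rV ri] Pi Pi' PP'; have P'P := mulmx1C PP'.
split=> // [i j|i|i]; last by rewrite !mxOverM.
- by rewrite rM -!mulmxA (mulmxA P' P) P'P mul1mx.
- by rewrite -!mulmxA (mulmxA P' P) P'P mul1mx (mulmxA (rho i)) rV mul1mx.
Qed.

Section LowerBlock.
Context {r s : nat} (rho : I -> 'M[R]_(r + s)).
Hypothesis arho : mx_action rho.
Hypothesis ur0 : forall i, ursubmx (rho i) = 0.

Let A i := ulsubmx (rho i).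
Let B i := dlsubmx (rho i).
Let D i := drsubmx (rho i).

Lemma rho_block i : rho i = block_mx (A i) 0 (B i) (D i).
Proof. by rewrite -[LHS]submxK ur0. Qed.

Lemma lower_block_mul i j : [/\ A (mul i j) = A i *m A j,
  B (mul i j) = B i *m A j + D i *m B j & D (mul i j) = D i *m D j].
Proof.
case: arho => rM _ _ _; have := rM i j.
rewrite !rho_block mulmx_block !mul0mx !mulmx0 !addr0 add0r.
by move=> /eq_block_mx[].
Qed.

Lemma lower_block_action : mx_action A /\ mx_action D.
Proof.
case: arho => rM mI rV ri.
have AD i : A i *m A (inv i) = 1%:M /\ D i *m D (inv i) = 1%:M.
  have := rV i; rewrite !rho_block mulmx_block !mul0mx !mulmx0 !addr0 add0r.
  by rewrite scalar_mx_block => /eq_block_mx[].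
split; split=> // i; try by move=> j; case: (lower_block_mul i j).
- by case: (AD i).
- by apply/mxOverP => k l; rewrite !mxE (mxOverP (ri i)).
- by case: (AD i).
- by apply/mxOverP => k l; rewrite !mxE (mxOverP (ri i)).
Qed.

(* The off-diagonal block is a 1-cocycle; multiplied by m = #|I| it is the
   coboundary of Y, so reducing Y modulo m bounds it. *)
Lemma cocycle_reduction c : 0 <= c ->
  (forall i, mx_bounded c (A i)) -> (forall i, mx_bounded c (D i)) ->
  exists2 X : 'M[R]_(s, r), X \is a intmx &
    forall i, mx_bounded ((r + s)%:R * c) (B i + X *m A i - D i *m X).
Proof.
move=> c0 Ac Dc; have [aA aD] := lower_block_action.
case: (arho) => _ mI _ ri.
pose Y := \sum_i B i *m invmx (A i).
pose m : R := #|I|%:R.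
have YE g : Y *m A g = m *: B g + D g *m Y.
  rewrite {1}/Y (reindex_inj (mI g)) mulmx_suml mulmx_sumr.
  have -> : m *: B g = \sum_(i : I) B g by rewrite sumr_const scaler_nat.
  rewrite -big_split; apply: eq_bigr => h _ /=.
  have [-> -> _] := lower_block_mul g h.
  have uA k := mx_action_unit k aA.
  have -> : invmx (A g *m A h) = invmx (A h) *m invmx (A g).
    by apply/esym/mulmx1_invmx; rewrite mulmxA mulmxK// mulmxV.
  rewrite -!mulmxA mulVmx// mulmx1 mulmxDl mulmxK// mulmxA//.
exists (- floormx (m^-1 *: Y)) => [|i].
  by rewrite -[- _]sub0r intmxB ?floormx_int//; apply/mxOverP => ? ?; rewrite mxE.
have m0 : 0 < m by rewrite ltr0n; apply/card_gt0P; exists i.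
set X := - _; pose Y0 := m^-1 *: Y + X.
have Y0b : mx_bounded 1 Y0.
  move=> k l; have /andP[a b] := floormx_frac (m^-1 *: Y) k l.
  by rewrite /Y0 /X ger0_norm// ltW.
have -> : B i + X *m A i - D i *m X = Y0 *m A i - D i *m Y0.
  rewrite /Y0 mulmxDl mulmxDr -scalemxAl YE -scalemxAr scalerDr scalerA mulVf
    ?gt_eqF// scale1r.
  by rewrite opprD !addrA; congr (_ - _); rewrite [RHS]addrAC addrK.
move=> k l; rewrite !mxE (le_trans (ler_normB _ _))//.
have := mx_boundedM Y0b (Ac i) k l; have := mx_boundedM (Dc i) Y0b k l.
by rewrite !mxE mul1r mulr1 natrD mulrDl => a b; exact: lerD.
Qed.

End LowerBlock.

(** Conjugation by diag(P1, P2) comes before [cocycle_reduction], whose bound depends on that of the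
    diagonal blocks. The unipotent matrix with lower left block X then leaves these blocks
    unchanged. The factor [(r + s).+1] covers both c and (r + s) c. *)
Lemma lower_block_bound r s (rho : I -> 'M[R]_(r + s)) c (P1 P1' : 'M[R]_r) (P2 P2' :
  'M[R]_s) :
  mx_action rho -> (forall i, ursubmx (rho i) = 0) -> 0 <= c ->
  P1 \is a intmx -> P1' \is a intmx -> P1 *m P1' = 1%:M ->
  P2 \is a intmx -> P2' \is a intmx -> P2 *m P2' = 1%:M ->
  (forall i, mx_bounded c (P1 *m ulsubmx (rho i) *m P1')) ->
  (forall i, mx_bounded c (P2 *m drsubmx (rho i) *m P2')) ->
  exists Q Q' : 'M[R]_(r + s), [/\ Q \is a intmx, Q' \is a intmx, Q *m Q' = 1%:M,
    ursubmx Q = 0 /\ ursubmx Q' = 0 &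
    forall i, mx_bounded ((r + s).+1%:R * c) (Q *m rho i *m Q')].
Proof.
move=> arho ur0 c0 P1i P1i' P1P P2i P2i' P2P P1c P2c.
pose S := block_mx P1 0 0 P2; pose S' := block_mx P1' 0 0 P2'.
have SS' : S *m S' = 1%:M.
  by rewrite mulmx_block !mul0mx !mulmx0 !addr0 add0r P1P P2P -scalar_mx_block.
have int_block p q p' q' (A : 'M[R]_(p, p')) (B : 'M[R]_(p, q')) (C : 'M[R]_(q, p'))
  (D : 'M[R]_(q, q')) :
    A \is a intmx -> B \is a intmx -> C \is a intmx -> D \is a intmx ->
    block_mx A B C D \is a intmx.
  move=> /mxOverP Ai /mxOverP Bi /mxOverP Ci /mxOverP Di; apply/mxOverP => i j.
  rewrite -[i]splitK -[j]splitK.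
  by case: (fintype.split i) => k; case: (fintype.split j) => l /=;
    rewrite ?block_mxEul ?block_mxEur ?block_mxEdl ?block_mxEdr.
have int0 a b : (0 : 'M[R]_(a, b)) \is a intmx by apply/mxOverP => i j; rewrite mxE.
have Si : S \is a intmx by exact: int_block.
have Si' : S' \is a intmx by exact: int_block.
pose rho' i := S *m rho i *m S'.
have arho' : mx_action rho' by exact: mx_action_conj.
have rho'E i : rho' i = block_mx (P1 *m ulsubmx (rho i) *m P1') 0
    (P2 *m dlsubmx (rho i) *m P1') (P2 *m drsubmx (rho i) *m P2').
  rewrite /rho' [in LHS]rho_block// !mulmx_block !mul0mx !mulmx0.
  by rewrite !(addr0, add0r) !mul0mx.
have [] := @cocycle_reduction _ _ rho' arho' _ c.
- by move=> i; rewrite rho'E block_mxKur.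
- exact: c0.
- by move=> i; rewrite rho'E block_mxKul.
- by move=> i; rewrite rho'E block_mxKdr.
move=> X Xi Xc.
pose U := block_mx 1%:M 0 X 1%:M : 'M[R]_(r + s).
pose U' := block_mx 1%:M 0 (- X) 1%:M : 'M[R]_(r + s).
have UU' : U *m U' = 1%:M.
  rewrite mulmx_block !mul0mx !mulmx0 !mulmx1 !mul1mx !addr0 add0r subrr.
  by rewrite -scalar_mx_block.
exists (U *m S), (S' *m U'); split.
- by rewrite mxOverM// int_block// intmx1.
- rewrite mxOverM// int_block ?intmx1//.
  by rewrite -[- X]sub0r intmxB.
- by rewrite mulmxA -(mulmxA U) SS' mulmx1.
- by rewrite !mulmx_block !mul0mx !mulmx0 !addr0 !block_mxKur.
move=> i; rewrite !mulmxA -(mulmxA U) -(mulmxA U) -/(rho' i) rho'E.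
have c1 : c <= (r + s).+1%:R * c by rewrite ler_peMl// ler1n.
have c2 : (r + s)%:R * c <= (r + s).+1%:R * c by rewrite ler_wpM2r// ler_nat.
have := Xc i; rewrite rho'E block_mxKul block_mxKdl block_mxKdr => Xci.
rewrite !mulmx_block !mul0mx !mulmx0 !mulmx1 !mul1mx !addr0 !add0r !mulmxN mul0mx subr0.
apply: mx_bounded_block.
- exact: (mx_boundedW c1 (P1c i)).
- by move=> k l; rewrite mxE normr0 mulr_ge0.
- rewrite [X in X - _]addrC; exact: (mx_boundedW c2 Xci).
- exact: (mx_boundedW c1 (P2c i)).
Qed.



End Actions.

(** * Lattices spanned by the orbit of a shortest vector *)

Section WellRounded.
Context {R : realType}.

(** By [W *m B = (K.+1%:R)%:M] the row lattice of [B] contains (K+1) Z^r, so reduction modulo K+1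
    changes [b] by an element of that lattice. *)
Lemma row_lattice_sub r K (W B : 'M[R]_r) (b : 'rV[R]_r) :
  W \is a intmx -> W *m B = (K.+1%:R)%:M -> b \is a intmx ->
  exists (a : 'rV['I_K.+1]_r) (q : 'rV[R]_r),
    [/\ q \is a intmx & b = map_mx (fun i : 'I_K.+1 => i%:R) a + q *m W *m B].
Proof.
move=> Wi WB bi; have K0 : 0 < K.+1%:R :> R by rewrite ltr0n.
pose q := floormx (K.+1%:R^-1 *: b).
pose rem j := b 0 j - K.+1%:R * q 0 j.
have rem_ge j : 0 <= rem j < K.+1%:R.
  have := floormx_frac (K.+1%:R^-1 *: b) 0 j; rewrite -/q [X in 0 <= X < _]mxE.
  rewrite [X in 0 <= X + _ < _]mxE [X in 0 <= _ + X < _]mxE => /andP[h1 h2].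
  have -> : rem j = K.+1%:R * (K.+1%:R^-1 * b 0 j - q 0 j).
    by rewrite mulrBr mulrA mulfV ?gt_eqF// mul1r.
  by rewrite mulr_ge0 ?(ltW K0)//= -[ltRHS]mulr1 ltr_pM2l.
have rem_nat j : rem j \is a Num.nat.
  rewrite natrEint; case/andP: (rem_ge j) => -> _; rewrite andbT.
  by rewrite rpredB ?(mxOverP bi)// rpredM ?rpred_nat// (mxOverP (floormx_int _)).
exists (\row_j inord (Num.truncn (rem j))), q; split; first exact: floormx_int.
rewrite -mulmxA WB mul_mx_scalar; apply/rowP => j; rewrite !mxE inordK.
  by rewrite truncnK//; rewrite /rem /q !mxE subrK.
by rewrite -(ltr_nat R) truncnK//; case/andP: (rem_ge j).
Qed.

(** A lattice between (K+1) Z^r and Z^r is determined by its residues modulo K+1, recorded in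
    [code], so there are finitely many. Fixing one basis for each, [U] passes from the rows of [B]
    to the fixed basis of the same lattice. *)
Lemma row_lattice_reps r K : exists2 c : R, 0 <= c & forall W B : 'M[R]_r,
  W \is a intmx -> B \is a intmx -> W *m B = (K.+1%:R)%:M ->
  exists U U' : 'M[R]_r, [/\ U \is a intmx, U' \is a intmx, U *m U' = 1%:M,
    mx_bounded c (U *m B) & mx_bounded c (invmx (U *m B))].
Proof.
pose good (B : 'M[R]_r) := B \is a intmx /\ exists2 W : 'M[R]_r,
  W \is a intmx & W *m B = (K.+1%:R)%:M.
pose lift (a : 'rV['I_K.+1]_r) : 'rV[R]_r := map_mx (fun i : 'I_K.+1 => i%:R) a.
pose code (B : 'M[R]_r) :=
  [set a | `[< exists2 z : 'rV[R]_r, z \is a intmx & lift a = z *m B >]]%SET.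
have gunit B : good B -> B \in unitmx.
  move=> [_ [W _ WB]]; have : K.+1%:R^-1 *: W *m B = 1%:M.
    by rewrite -scalemxAl WB scale_scalar_mx mulVf// pnatr_eq0.
  by case/mulmx1_unit.
have codeS B B0 : good B -> good B0 -> code B0 = code B ->
    exists2 U : 'M[R]_r, U \is a intmx & U *m B = B0.
  move=> [Bi [W Wi WB]] [B0i [W0 W0i WB0]] eqc.
  have rowP i : exists2 z : 'rV[R]_r, z \is a intmx & z *m B = row i B0.
    have ri : row i B0 \is a intmx by apply/mxOverP => k l; rewrite mxE (mxOverP B0i).
    have [a [q [qi rE]]] := row_lattice_sub Wi WB ri.
    have : a \in code B0.
      rewrite inE; apply/asboolP; exists (delta_mx 0 i - q *m W0).
        rewrite intmxB ?mxOverM//; apply/mxOverP => k l; rewrite mxE; exact: rpred_nat.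
      by rewrite mulmxBl -rowE rE -!mulmxA WB0 WB addrK.
    rewrite eqc inE => /asboolP[z zi az]; exists (z + q *m W).
      by rewrite intmxD// mxOverM.
    by rewrite mulmxDl -az -rE.
  have [f fP] := choice (fun i => let: ex_intro2 z zi zB := rowP i in ex_intro (fun z
    => z \is a intmx /\ z *m B = row i B0) z (conj zi zB)).
  exists (\matrix_i f i).
    by apply/mxOverP => i j; rewrite mxE; case: (fP i) => /mxOverP.
  by apply/row_matrixP => i; rewrite row_mul rowK; case: (fP i).
have [||c c0 Pc] := @uniform_bound R {set 'rV['I_K.+1]_r} (fun S c => forall B, good B
  -> code B = S ->
    exists U U' : 'M[R]_r, [/\ U \is a intmx, U' \is a intmx, U *m U' = 1%:M,
    mx_bounded c (U *m B) & mx_bounded c (invmx (U *m B))]).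
- move=> S c c' Pc cc B gB cB; have [U [U' [Ui Ui' UU h1 h2]]] := Pc B gB cB.
  by exists U, U'; split=> //; exact: mx_boundedW cc _.
(* A set of residues that no lattice realises imposes no condition, so the constant 0 serves. *)
- move=> S; have [[B0 gB0 cB0]|nB0] := pselect (exists2 B0, good B0 & code B0 = S);
  last first.
    by exists 0 => B gB cB; case: nB0; exists B.
  have [c1 c10 B0c1] := mx_bounded_exists B0.
  have [c2 c20 B0c2] := mx_bounded_exists (invmx B0).
  exists (c1 + c2) => B gB cB.
  have [U Ui UB] := codeS B B0 gB gB0 (etrans cB0 (esym cB)).
  have [U' Ui' UB'] := codeS B0 B gB0 gB (etrans cB (esym cB0)).
  exists U, U'; split=> //.
  + by rewrite -[LHS](mulmxK (gunit _ gB0)) -(mulmxA U) UB' UB mulmxV// gunit.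
  + by rewrite UB; apply: mx_boundedW B0c1; rewrite lerDl.
  + by rewrite UB; apply: mx_boundedW B0c2; rewrite lerDr.
- by exists c => // W B Wi Bi WB; apply: (Pc (code B)) => //; split=> //; exists W.
Qed.

(* W consists of r independent vectors of the orbit of the shortest vector v,
   chosen with |det W| maximal: by Cramer's rule all orbit vectors have
   coordinates in [-1, 1] with respect to W, and minimality of v bounds the
   index of the row lattice of W. *)
Lemma well_rounded_bound r : exists2 c : R, 0 <= c &
  forall (I : finType) (mul : I -> I -> I) (inv : I -> I) (rho : I -> 'M[R]_r)
    (q : 'rV[R]_r -> R) (v : 'rV[R]_r),
  mx_action mul inv rho ->
  (forall (a : 'I_r -> R) (w : 'I_r -> 'rV[R]_r),
    q (\sum_j a j *: w j) <= r%:R * \sum_j a j ^+ 2 * q (w j)) ->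
  (forall i, q (v *m rho i) = q v) -> 0 < q v -> v \is a intmx ->
  (forall x, x \is a intmx -> x != 0 -> q v <= q x) ->
  row_full (\matrix_(k < #|I|) (v *m rho (enum_val k))) ->
  exists P P' : 'M[R]_r, [/\ P \is a intmx, P' \is a intmx, P *m P' = 1%:M &
    forall i, mx_bounded c (P *m rho i *m P')].
Proof.
(* [K.+1] is the common denominator that [dirichlet] provides for boxes of side 1/(r+1). *)
pose K := ((r.+1 ^ r)`!).-1; have KE : K.+1 = (r.+1 ^ r)`! by rewrite prednK// fact_gt0.
have [c c0 reps] := row_lattice_reps r K.
(* Bound for a product of three matrices with entries bounded by c, 1 and c: the conjugated action
   is (U B) Y (U B)^-1, where Y is the action in the basis W. *)
exists (r%:R * (r%:R * (c * 1) * c)); first by rewrite !mulr_ge0.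
move=> I mul inv rho q v arho qsum qinv qv0 vi vmin full.
case: (arho) => rM mI rV ri.
pose Wm (s : {ffun 'I_r -> I}) : 'M[R]_r := \matrix_j (v *m rho (s j)).
pose s1 := [ffun j => enum_val (fullrankfun full j)].
have us1 : Wm s1 \in unitmx.
  have -> : Wm s1 = rowsub (fullrankfun full) (\matrix_(k < #|I|) (v *m rho (enum_val k))).
    by apply/row_matrixP => j; rewrite row_rowsub !rowK ffunE.
  exact: fullrowsub_unit.
pose s := [arg max_(s > s1) `|\det (Wm s)|]%O.
have smax t : `|\det (Wm t)| <= `|\det (Wm s)|.
  by rewrite /s; case: arg_maxP => // u _; apply.
set W := Wm s in smax.
have dW : 0 < `|\det W|.
  by apply: lt_le_trans (smax s1); rewrite normr_gt0 -unitfE -unitmxE.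
have uW : W \in unitmx by rewrite unitmxE unitfE -normr_gt0.
have coord i j : `|(v *m rho i *m invmx W) 0 j| <= 1.
  rewrite -(ler_pM2r dW) mul1r -normrM -det_replace_coord//.
  have -> : \matrix_k (if k == j then v *m rho i else row k W) = Wm [ffun k => if k ==
    j then i else s k].
    by apply/row_matrixP => k; rewrite !rowK ffunE; case: eqP.
  exact: smax.
have rowW j : row j W = v *m rho (s j) by rewrite rowK.
have Wi : W \is a intmx.
  by apply/mxOverP => i j; rewrite mxE (mxOverP (mxOverM vi (ri (s i)))).
pose T : set 'rV[R]_r := [set x | x \is a intmx].
have zT : zmod_set T.
  by split=> [|x y]; [apply/mxOverP => i j; rewrite mxE|exact: intmxB].
(* A combination of the rows of [W] with coefficients below 1/(r+1) has [q] at most (r/(r+1))^2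
   [q v], less than the minimum, so it vanishes. *)
have sep (y : 'rV_r) : (forall j, `|y 0 j| < r.+1%:R^-1) -> T (y *m W) -> y = 0.
  move=> yK yW; suff : y *m W = 0 by move=> /(congr1 (mulmx^~ (invmx W)));
    rewrite mulmxK// mul0mx.
  apply/eqP; rewrite -[_ == 0]negbK; apply/negP => /(vmin _ yW); apply/negP; rewrite -ltNge.
  rewrite mulmx_sum_row (le_lt_trans (qsum _ _))//.
  apply: (@le_lt_trans _ _ (r%:R * (\sum_(j < r) r.+1%:R^-1 ^+ 2 * q v))).
    rewrite ler_wpM2l// ler_sum// => j _; rewrite rowW qinv ler_wpM2r ?(ltW qv0)//.
    by rewrite -real_normK ?num_real// lerXn2r ?nnegrE ?invr_ge0// ltW.
  rewrite sumr_const card_ord -[X in _ * X]mulr_natl.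
  have -> : r%:R * (r%:R * (r.+1%:R^-1 ^+ 2 * q v)) = (r%:R / r.+1%:R) ^+ 2 * q v by ring.
  rewrite -[ltRHS]mul1r ltr_pM2r// expr_lt1// ?divr_ge0//.
  by rewrite ltr_pdivrMr ?ltr0n// mul1r ltr_nat.
(* The rows of [B] are the standard basis in [W]-coordinates, cleared of denominators. As [B] is a
   scalar multiple of the inverse of [W], conjugating by [U *m B] in the basis [W] amounts to
   conjugating by [U] in the standard basis. *)
pose B := K.+1%:R *: invmx W.
have Bi : B \is a intmx.
  have TW i : T (row i W) by rewrite /T/= rowW; exact: mxOverM.
  apply/mxOverP => i j.
  have T1 : T (row i 1%:M) by apply/mxOverP => k l; rewrite !mxE rpred_nat.
  have := dirichlet zT uW TW sep T1; rewrite -KE -row_mul mul1mx => /mxOverP/(_ 0 j).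
  by rewrite !mxE.
have WB : W *m B = (K.+1%:R)%:M by rewrite -scalemxAr mulmxV// scale_scalar_mx mulr1.
have [U [U' [Ui Ui' UU' H1 H2]]] := reps _ _ Wi Bi WB.
exists U, U'; split=> // i.
pose Y := W *m rho i *m invmx W.
have Y1 : mx_bounded 1 Y.
  move=> k l; have -> : Y k l = (v *m rho (mul (s k) i) *m invmx W) 0 l.
    by rewrite rM mulmxA -rowW -!row_mul [RHS]mxE.
  exact: coord.
have uB : B \in unitmx by rewrite unitmxZ ?unitmx_inv// unitfE pnatr_eq0.
have -> : U *m rho i *m U' = U *m B *m Y *m invmx (U *m B).
  have -> : invmx (U *m B) = invmx B *m U'.
    apply/esym/mulmx1_invmx; rewrite mulmxA -(mulmxA U) mulmxV// mulmx1//.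
  rewrite /Y !mulmxA; congr (_ *m _).
  have -> : U *m B *m W = K.+1%:R *: U.
    by rewrite -mulmxA -scalemxAl mulVmx// -scalemxAr mulmx1.
  have WBinv : invmx W *m invmx B = (K.+1%:R^-1)%:M.
    have -> : invmx W *m invmx B = invmx (B *m W).
      by apply/mulmx1_invmx; rewrite mulmxA mulmxK// mulmxV.
    have -> : B *m W = (K.+1%:R)%:M by rewrite -scalemxAl mulVmx// scale_scalar_mx mulr1.
    by rewrite invmx_scalar.
  rewrite -!scalemxAl -!mulmxA WBinv mul_mx_scalar -scalemxAr scalerA.
  by rewrite mulfV ?scale1r// pnatr_eq0.
apply: mx_boundedM => //; exact: mx_boundedM.
Qed.

End WellRounded.

(** * Jordan-Zassenhaus bounds for integral actions *)

Section ActionBound.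
Context {R : realType}.

Definition action_bounded n (c : R) :=
  forall (I : finType) (mul : I -> I -> I) (inv : I -> I)
    (rho : I -> 'M[R]_n), mx_action mul inv rho ->
  exists P P' : 'M[R]_n, [/\ P \is a intmx, P' \is a intmx, P *m P' = 1%:M &
    forall i, mx_bounded c (P *m rho i *m P')].

Lemma orbit_sqn n (I : finType) (mul : I -> I -> I) (inv : I -> I) (rho : I -> 'M[R]_n) :
  mx_action mul inv rho -> forall x i,
  \sum_j sqn (x *m rho i *m rho j : 'rV_n) = \sum_j sqn (x *m rho j).
Proof.
move=> [rM mI _ _] x i; rewrite [RHS](reindex_inj (mI i)).
by apply: eq_bigr => j _; rewrite rM mulmxA.
Qed.

(** The integral vectors in the real span of the orbit of [v] form a pure invariant sublattice, to
    which [adapted_basis] applies. The equation [e] allows n to be replaced by r + s, so that block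
    operations typecheck. *)
Lemma orbit_span_basis n (I : finType) (mul : I -> I -> I) (inv : I -> I)
    (rho : I -> 'M[R]_n) (v : 'rV[R]_n) : mx_action mul inv rho -> v \is a intmx ->
  v != 0 -> (0 < #|I|)%N ->
  exists r s (e : (r + s)%N = n) (E : 'M[R]_(r + s, n)) (E' : 'M[R]_(n, r + s)),
    [/\ (0 < r)%N, E \is a intmx, E' \is a intmx, E *m E' = 1%:M &
      [/\ forall i, ursubmx (E *m rho i *m E') = 0, rsubmx (v *m E') = 0 &
          row_full (\matrix_(k < #|I|)
            (lsubmx (v *m E') *m ulsubmx (E *m rho (enum_val k) *m E')))]].
Proof.
move=> arho vi v0 I0; case: (arho) => rM mI rV ri.
pose O := \matrix_(k < #|I|) (v *m rho (enum_val k)).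
pose T : set 'rV[R]_n := [set x | x \is a intmx].
pose L : set 'rV[R]_n := [set x | x \is a intmx /\ (x <= O)%MS].
have int0 : (0 : 'rV[R]_n) \is a intmx by apply/mxOverP => i j; rewrite mxE.
have zT : zmod_set T by split=> // x y; exact: intmxB.
have dT : discrete_set T.
  exists 1 => // x xi x1; apply/rowP => j; rewrite mxE.
  by apply: int_norm_lt1 => //; exact: (mxOverP xi).
have zL : zmod_set L.
  split=> [|x y [xi xO] [yi yO]]; first by split; rewrite ?sub0mx.
  by split; [exact: intmxB|rewrite addmx_sub// eqmx_opp].
have TE1 i : T (row i 1%:M) by apply/mxOverP => k l; rewrite !mxE rpred_nat.
have Lpure x k : T x -> (0 < k)%N -> L (x *+ k) -> L x.
  move=> Tx k0 [_ kO]; split=> //; move: kO.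
  by rewrite -scaler_nat eqmx_scale// pnatr_eq0 -lt0n.
have [|r [E [rn uE TE LE]]] := adapted_basis zT dT (unitmx1 _ _) TE1 zL _ Lpure.
  by move=> x [].
have Lrho x i : L x -> L (x *m rho i).
  move=> [xi xO]; split; first by rewrite mxOverM.
  apply: submx_trans (submxMr _ xO) _; apply/row_subP => k.
  rewrite row_mul rowK -mulmxA -rM.
  by apply: eq_row_sub (enum_rank (mul (enum_val k) i)) _; rewrite rowK enum_rankK.
have vL : L v.
  split=> //; have /card_gt0P[i _] := I0; pose i1 := mul i (inv i).
  have r1 : rho i1 = 1%:M by rewrite rM rV.
  by apply: eq_row_sub (enum_rank i1) _; rewrite rowK enum_rankK r1 mulmx1.
have Ei : E \is a intmx.
  apply/mxOverP => i j; have /mxOverP/(_ 0 j) : row i E \is a intmx.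
    apply/TE; rewrite -row_mul mulmxV//.
    by apply/mxOverP => k l; rewrite !mxE rpred_nat.
  by rewrite mxE.
have Ei' : invmx E \is a intmx.
  apply/mxOverP => i j; have /TE/mxOverP/(_ 0 j) := TE1 i.
  by rewrite -row_mul mul1mx mxE.
have [s e] : exists s, (r + s)%N = n by exists (n - r)%N; rewrite subnKC.
exists r, s, e.
subst n; exists E, (invmx E).
have Lr x : L x -> rsubmx (x *m invmx E) = 0.
  move=> /LE[_ x0]; apply/rowP => j; rewrite !mxE; apply: etrans (x0 (rshift r j) _).
    by rewrite mxE.
  by rewrite /= leq_addr.
have rowL (k : 'I_r) : L (row (lshift s k) E).
  apply/LE; rewrite -row_mul mulmxV//; split=> [|j rj].
    by apply/mxOverP => a b; rewrite !mxE rpred_nat.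
  rewrite !mxE; case: eqP => // kj; move: rj; rewrite -kj /= leqNgt.
  by have := ltn_ord k; rewrite /= => ->.
have ur0 i : ursubmx (E *m rho i *m invmx E) = 0.
  apply/row_matrixP => k; rewrite row0 -(Lr _ (Lrho _ i (rowL k))).
  by apply/rowP => l; rewrite -!row_mul !mxE.
split=> //.
  rewrite lt0n; apply: contra_neq v0 => r0; subst r.
  have [_ v0] := (LE v).1 vL; rewrite -[v](mulmxKV uE).
  suff -> : v *m invmx E = 0 by rewrite mul0mx.
  by apply/rowP => j; rewrite v0// mxE.
  by rewrite mulmxV.
split=> //; first exact: Lr.
apply/row_fullP.
have sub k : exists z : 'rV[R]_#|I|, z *m O = row (lshift s k) E.
  by have [_ /submxP[z ->]] := rowL k; exists z.
have [f fP] := choice sub.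
exists (\matrix_k f k); apply/row_matrixP => k.
rewrite row_mul rowK.
set O' := \matrix_k0 _.
have OO' : O *m invmx E = row_mx O' 0.
  apply/row_matrixP => a; rewrite row_mul rowK row_row_mx rowK row0.
  have -> : v *m rho (enum_val a) *m invmx E = (v *m invmx E) *m (E *m rho (enum_val
    a) *m invmx E).
    by rewrite !mulmxA mulmxKV.
  rewrite -[v *m invmx E]hsubmxK Lr// -[X in row_mx _ _ *m X]submxK ur0 mul_row_block.
  by rewrite !mul0mx !mulmx0 !addr0 row_mxKl.
have : f k *m O *m invmx E = row_mx (f k *m O') 0 by rewrite -mulmxA OO' mul_mx_row mulmx0.
rewrite fP -row_mul mulmxV// => /(congr1 lsubmx); rewrite row_mxKl => <-.
by apply/rowP => l; rewrite !mxE.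
Qed.

Lemma choice_ge0 (P : nat -> R -> Prop) : (forall m, exists2 c, 0 <= c & P m c) ->
  exists f : nat -> R, forall m, 0 <= f m /\ P m (f m).
Proof.
move=> H; have [|f fP] := @choice _ _ (fun m c => 0 <= c /\ P m c); last by exists f.
by move=> m; have [c c0 Pc] := H m; exists c.
Qed.

(** The form summed over the orbit takes natural values on integral vectors, so a minimum is
    attained; it is positive because each [rho j] is invertible. *)
Lemma shortest_vector n (I : finType) (mul : I -> I -> I) (inv : I -> I) (rho : I ->
  'M[R]_n) :
  mx_action mul inv rho -> (0 < n)%N -> (0 < #|I|)%N ->
  exists v : 'rV[R]_n, [/\ v \is a intmx, v != 0, 0 < \sum_j sqn (v *m rho j) &
    forall x : 'rV[R]_n, x \is a intmx -> x != 0 ->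
      \sum_j sqn (v *m rho j) <= \sum_j sqn (x *m rho j)].
Proof.
move=> arho n0 I0; case: (arho) => rM mI rV ri.
pose q (x : 'rV[R]_n) := \sum_j sqn (x *m rho j).
have q0 x : 0 <= q x by rewrite sumr_ge0// => j _; exact: sqn_ge0.
have qnat x : x \is a intmx -> exists k, q x = k%:R.
  move=> xi; exists (Num.truncn (q x)); rewrite truncnK// natrEint q0 andbT.
  rewrite rpred_sum// => j _; rewrite rpred_sum// => k _; rewrite rpred_sum// => l _.
  by rewrite rpredX// (mxOverP (mxOverM xi (ri j))).
have [|k [[v [vi v0 vk]] kmin]] := @ex_minimal
    (fun k => exists v : 'rV[R]_n, [/\ v \is a intmx, v != 0 & q v = k%:R])
    (Num.truncn (q (delta_mx 0 (Ordinal n0)))).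
  have di : (delta_mx 0 (Ordinal n0) : 'rV[R]_n) \is a intmx.
    by apply/mxOverP => i j; rewrite mxE rpred_nat.
  exists (delta_mx 0 (Ordinal n0)); split=> //; last first.
    by have [k kq] := qnat _ di; rewrite kq natrK.
  apply/eqP => /rowP/(_ (Ordinal n0)); rewrite !mxE !eqxx => /eqP.
  by rewrite oner_eq0.
exists v; split=> //.
- rewrite lt_neqAle q0 andbT; apply: contra_neqN v0 => /eqP/esym qv.
  have /card_gt0P[i _] := I0.
  have /eqP : q v = 0 by [].
  rewrite psumr_eq0 => [/allP/(_ i (mem_index_enum _))/implyP/(_ isT)/eqP/sqn_eq0 vr|j
    _]; last exact: sqn_ge0.
  by rewrite -[v](mulmxK (mx_action_unit i arho)) vr mul0mx.
- move=> x xi x0; have [l lq] := qnat x xi.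
  by rewrite -/(q v) -/(q x) vk lq ler_nat; apply: kmin; exists x.
Qed.

(** The constant depends on n alone, not on the group or its order. The sublattice of
    [orbit_span_basis] is handled by [well_rounded_bound]; the quotient has smaller rank because r >
    0, so induction applies. *)
Lemma action_bound n : exists2 c : R, 0 <= c & action_bounded n c.
Proof.
have [n0] := ubnP n; elim: n0 n => // n0 IH n; rewrite ltnS => nn0.
have [b bP] : exists b : nat -> R, forall m,
  0 <= b m /\ ((m < n)%N -> action_bounded m (b m)).
  apply: (@choice_ge0 (fun m c => (m < n)%N -> action_bounded m c)) => m.
  (* Nothing is claimed for m >= n; 0 is a default. *)
  have [mn|_] := ltnP m n; last by exists 0.
  by have [c c0 mc] := IH m (leq_trans mn nn0); exists c.
have [w wP] := choice_ge0 (well_rounded_bound (R := R)).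
have wb0 r : 0 <= w r + b (n - r)%N by rewrite addr_ge0; case: (wP r); case: (bP (n - r)%N).
(* The rank r of the sublattice depends on the action, so the constants for all ranks are added;
   [n.+1] is the factor of [lower_block_bound]. *)
exists (n.+1%:R * \sum_(r < n.+1) (w r + b (n - r)%N)).
  by rewrite mulr_ge0// sumr_ge0.
move=> I mul inv rho arho; case: (arho) => rM mI rV ri.
have [n_eq0|n_gt0] := posnP n.
  subst n; exists 1%:M, 1%:M; split; rewrite ?intmx1 ?mulmx1//.
  by move=> i [].
have [I0|I_gt0] := posnP #|I|.
  exists 1%:M, 1%:M; split; rewrite ?intmx1 ?mulmx1// => i.
  by have := card0_eq I0 i; rewrite inE.
have [v [vi v0 qv0 vmin]] := shortest_vector arho n_gt0 I_gt0.
have [r [s [e [E [E' [r0 Ei Ei' EE' [ur0 vE' full]]]]]]] :=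
  orbit_span_basis arho vi v0 I_gt0.
subst n; have E'E := mulmx1C EE'.
have arho' := mx_action_conj arho Ei Ei' EE'.
have [aA aD] := lower_block_action arho' ur0.
(* The averaged form restricted to the sublattice, in the coordinates given by the first r rows of
   [E]. *)
pose q (x : 'rV[R]_r) := \sum_j sqn (x *m usubmx E *m rho j).
have urow (x : 'rV[R]_r) : x *m usubmx E = row_mx x 0 *m E.
  by rewrite -[in RHS](vsubmxK E) mul_row_col mul0mx addr0.
pose v' := lsubmx (v *m E').
have v'E : v' *m usubmx E = v by rewrite urow -vE' hsubmxK -mulmxA E'E mulmx1.
have qv' : q v' = \sum_j sqn (v *m rho j) by rewrite /q v'E.
have [P1 [P1' [P1i P1i' P1P P1b]]] : exists P P' : 'M[R]_r,
  [/\ P \is a intmx, P' \is a intmx, P *m P' = 1%:M &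
    forall i, mx_bounded (w r) (P *m ulsubmx (E *m rho i *m E') *m P')].
  case: (wP r) => _ /(_ I mul inv _ q v'); apply => //.
  - move=> a z; rewrite /q.
    have -> : r%:R * (\sum_j a j ^+ 2 * \sum_k sqn (z j *m usubmx E *m rho k)) =
        \sum_k r%:R * \sum_j sqn (a j *: (z j *m usubmx E *m rho k)).
      rewrite -mulr_sumr; congr (_ * _); rewrite exchange_big; apply: eq_bigr => j _.
      by rewrite mulr_sumr; apply: eq_bigr => k _; rewrite sqnZ.
    apply: ler_sum => k _; rewrite !mulmx_suml.
    have := sqn_sum_le (fun j => a j *: (z j *m usubmx E *m rho k)).
    rewrite card_ord; congr (sqn _ <= _); apply: eq_bigr => j _.
    by rewrite !scalemxAl.
  - move=> i; rewrite qv' -(orbit_sqn arho v i) /q; apply: eq_bigr => j _.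
    congr (sqn (_ *m _)); rewrite urow.
    have -> : row_mx (v' *m ulsubmx (E *m rho i *m E')) 0 = v *m E' *m (E *m rho i *m E').
      rewrite -[v *m E']hsubmxK vE' -[X in _ = _ *m X]submxK ur0 mul_row_block.
      by rewrite !mul0mx !mulmx0 !addr0.
    by rewrite !mulmxA -(mulmxA v) E'E mulmx1 -mulmxA E'E mulmx1.
  - by rewrite qv'.
  - by apply/mxOverP => i j; rewrite mxE (mxOverP (mxOverM vi Ei')).
  - move=> x xi x0; rewrite qv'; apply: vmin.
      by rewrite mxOverM//; apply/mxOverP => i j; rewrite mxE (mxOverP Ei).
    apply: contra_neq x0; rewrite urow => /(congr1 (mulmx^~ E')).
    by rewrite -mulmxA EE' mulmx1 mul0mx => /(congr1 lsubmx); rewrite row_mxKl linear0.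
have [|P2 [P2' [P2i P2i' P2P P2b]]] := (bP s).2 _ I mul inv _ aD.
  by rewrite -[X in (X < _)%N]add0n ltn_add2r.
have [|||Q [Q' [Qi Qi' QQ' _ Qb]]] := @lower_block_bound _ _ _ _ _ _ _ (w r + b s)
  _ _ _ _ arho' ur0 _ P1i P1i' P1P P2i P2i' P2P.
- by rewrite addr_ge0//; case: (wP r); case: (bP s).
- by move=> i; apply: mx_boundedW (P1b i); rewrite lerDl; case: (bP s).
- by move=> i; apply: mx_boundedW (P2b i); rewrite lerDr; case: (wP r).
exists (Q *m E), (E' *m Q'); split.
- exact: mxOverM.
- exact: mxOverM.
- by rewrite mulmxA -(mulmxA Q) EE' mulmx1.
move=> i; apply: mx_boundedW (_ : mx_bounded ((r + s).+1%:R * (w r + b s)) _).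
  rewrite ler_wpM2l//.
  have rs : (r < (r + s).+1)%N by rewrite ltnS leq_addr.
  by rewrite (bigD1 (Ordinal rs))//= addKn lerDl sumr_ge0.
have -> : Q *m E *m rho i *m (E' *m Q') = Q *m (E *m rho i *m E') *m Q' by rewrite !mulmxA.
exact: Qb.
Qed.

(** Since matrices act on row vectors from the right, this says that the span of the first r basis
    vectors is invariant. Comparing indices avoids writing n as a sum. *)
Definition lower_block n r (A : 'M[R]_n) :=
  forall k l : 'I_n, (k < r)%N -> (r <= l)%N -> A k l = 0.

(** The basis change from [action_bound] may destroy the given sublattice, so [action_bound] is
    applied to each diagonal block and [lower_block_bound] reassembles them by block triangular
    matrices. *)
Lemma flag_action_bound n : exists2 c : R, 0 <= c &
  forall r (I : finType) (mul : I -> I -> I) (inv : I -> I) (rho : I -> 'M[R]_n),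
    (r <= n)%N -> mx_action mul inv rho -> (forall i, lower_block r (rho i)) ->
  exists P P' : 'M[R]_n, [/\ P \is a intmx, P' \is a intmx, P *m P' = 1%:M,
    lower_block r P /\ lower_block r P' &
    forall i, mx_bounded c (P *m rho i *m P')].
Proof.
have [b bP] := choice_ge0 action_bound.
have b0 m : 0 <= b m by case: (bP m).
exists (n.+1%:R * \sum_(r < n.+1) (b r + b (n - r)%N)).
  by rewrite mulr_ge0// sumr_ge0// => r _; rewrite addr_ge0.
move=> r I mul inv rho rn arho low.
have [s e] : exists s, (r + s)%N = n by exists (n - r)%N; rewrite subnKC.
subst n.
have lowE (A : 'M[R]_(r + s)) : lower_block r A <-> ursubmx A = 0.
  split=> [lA|A0 k l kr rl].
    by apply/matrixP => i j; rewrite !mxE lA//= leq_addr.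
  have ls : (l - r < s)%N by rewrite ltn_subLR.
  move/matrixP/(_ (Ordinal kr) (Ordinal ls)): A0; rewrite !mxE.
  by congr (A _ _ = 0); apply/val_inj => //=; rewrite subnKC.
have ur0 i : ursubmx (rho i) = 0 by apply/lowE.
have [aA aD] := lower_block_action arho ur0.
have [P1 [P1' [P1i P1i' P1P P1b]]] := (bP r).2 _ _ _ _ aA.
have [P2 [P2' [P2i P2i' P2P P2b]]] := (bP s).2 _ _ _ _ aD.
have [|||Q [Q' [Qi Qi' QQ' [Q0 Q0'] Qb]]] :=
  @lower_block_bound _ _ _ _ _ _ _ (b r + b s) _ _ _ _ arho ur0 _ P1i P1i' P1P P2i P2i' P2P.
- by rewrite addr_ge0.
- by move=> i; apply: mx_boundedW (P1b i); rewrite lerDl.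
- by move=> i; apply: mx_boundedW (P2b i); rewrite lerDr.
exists Q, Q'; split=> //; first by split; apply/lowE.
move=> i; apply: mx_boundedW (Qb i).
rewrite ler_wpM2l//.
have rs : (r < (r + s).+1)%N by rewrite ltnS leq_addr.
rewrite (bigD1 (Ordinal rs))//= addKn lerDl sumr_ge0// => k _.
by rewrite addr_ge0.
Qed.

End ActionBound.

(** * Euclidean isometries *)

Section Isometry.
Context {R : realType} {n : nat}.
Implicit Types (f g : euclid_isometry R n) (x y : 'rV[R]_n).

Definition tr f : 'rV[R]_n := f 0.
Definition lin f : 'M[R]_n := \matrix_i (f (delta_mx 0 i) - f 0).

Lemma edistE x y : Defs.edist x y = fnorm (x - y).
Proof. by rewrite /Defs.edist /fnorm /sqn big_ord1; congr Num.sqrt; apply: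
  eq_bigr => i _; rewrite !mxE. Qed.

Lemma isometry_fnorm f x y : fnorm (f x - f y) = fnorm (x - y).
Proof. by rewrite -!edistE isometry_edist. Qed.

Definition dot x y : R := \sum_j x 0 j * y 0 j.

Lemma sqnB_dot x y : sqn (x - y) = sqn x + sqn y - dot x y *+ 2.
Proof.
rewrite sqnD -scaleN1r sqnZ sqrrN expr1n mul1r big_ord1; congr (_ + _).
rewrite -mulNrn -sumrN; congr (_ *+ _); apply: eq_bigr => j _.
by rewrite !mxE mulN1r mulrN.
Qed.

Lemma isometry_dot f x y : dot (f x - f 0) (f y - f 0) = dot x y.
Proof.
have sq u v : sqn (f u - f v) = sqn (u - v) by rewrite !sqn_sqr isometry_fnorm.
have := sqnB_dot (f x - f 0) (f y - f 0).
rewrite opprB addrA subrK !sq !subr0 sqnB_dot => /addrI/oppr_inj/eqP.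
by rewrite eqr_pMn2r// => /eqP ->.
Qed.

Lemma lin_orth f : lin f *m (lin f)^T = 1%:M.
Proof.
apply/matrixP => i j; have := isometry_dot f (delta_mx 0 i) (delta_mx 0 j).
rewrite !mxE => H; apply: etrans (etrans H _).
  by apply: eq_bigr => k _; rewrite !mxE.
rewrite /dot (bigD1 i)//= big1 => [|k ki]; first by rewrite !mxE !eqxx mul1r addr0.
by rewrite !mxE (negbTE ki) mul0r.
Qed.

Lemma lin_orthC f : (lin f)^T *m lin f = 1%:M.
Proof. exact: mulmx1C (lin_orth f). Qed.

(** By polarisation, f x - f 0 has the same products with the orthonormal rows of [lin f] as [x] has
    with the standard basis. *)
Lemma isometry_affine f x : f x = x *m lin f + tr f.
Proof.
suff H : (f x - f 0) *m (lin f)^T = x.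
  by rewrite -[X in _ = X *m _ + _]H -mulmxA lin_orthC mulmx1 subrK.
apply/rowP => j; have := isometry_dot f x (delta_mx 0 j).
rewrite /dot [RHS](bigD1 j)//= [in RHS]big1 => [H|k kj]; last first.
  by rewrite !mxE (negbTE kj) mulr0.
rewrite mxE; apply: etrans (etrans H _); first by apply: eq_bigr => k _; rewrite !mxE.
by rewrite !mxE !eqxx mulr1 addr0.
Qed.

Lemma affine_lin_tr f A b : (forall x, f x = x *m A + b) -> lin f = A /\ tr f = b.
Proof.
move=> fE; split; last by rewrite /tr fE mul0mx add0r.
by apply/row_matrixP => i; rewrite rowK !fE mul0mx add0r addrK -rowE.
Qed.

Lemma isometry_eq f g : lin f = lin g -> tr f = tr g -> f = g.
Proof. by move=> lfg tfg; apply: isometryP => x; rewrite !isometry_affine lfg tfg. Qed.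

Lemma isometry_mulE f g x : (f * g)%g x = f (g x).
Proof. by []. Qed.

Lemma isometry_1E x : (1%g : euclid_isometry R n) x = x.
Proof. by []. Qed.

(** Composition applies the right factor first while matrices act on row vectors from the right, so
    [lin] reverses products. *)
Lemma lin_tr_mul f g :
  lin (f * g)%g = lin g *m lin f /\ tr (f * g)%g = tr g *m lin f + tr f.
Proof.
apply: affine_lin_tr => x; rewrite isometry_mulE isometry_affine (isometry_affine g).
by rewrite mulmxDl mulmxA addrA.
Qed.

Lemma linM f g : lin (f * g)%g = lin g *m lin f.
Proof. by case: (lin_tr_mul f g). Qed.

Lemma trM f g : tr (f * g)%g = tr g *m lin f + tr f.
Proof. by case: (lin_tr_mul f g). Qed.

Lemma lin1 : lin (1%g : euclid_isometry R n) = 1%:M.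
Proof. by apply: (affine_lin_tr (b := 0) _).1 => x; rewrite mulmx1 addr0. Qed.

Lemma tr1 : tr (1%g : euclid_isometry R n) = 0.
Proof. by []. Qed.

Lemma lin_unit f : lin f \in unitmx.
Proof. by case/mulmx1_unit: (lin_orth f). Qed.

Lemma linV f : lin (f^-1)%g = (lin f)^T.
Proof.
have := linM f (f^-1)%g; rewrite mulgV lin1 => /(congr1 (mulmx^~ (lin f)^T)).
by rewrite -mulmxA lin_orth mul1mx mulmx1.
Qed.

Lemma trV f : tr (f^-1)%g = - (tr f *m (lin f)^T).
Proof.
have := trM f (f^-1)%g; rewrite mulgV tr1 => /eqP.
rewrite eq_sym addr_eq0 => /eqP/(congr1 (mulmx^~ (lin f)^T)).
by rewrite -mulmxA lin_orth mulmx1 mulNmx.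
Qed.

Lemma fnorm_lin f m (A : 'M[R]_(m, n)) : fnorm (A *m lin f) = fnorm A.
Proof. by rewrite fnorm_mulmx_orth// lin_orth. Qed.

Lemma fnorm_lin_tr f m (A : 'M[R]_(m, n)) : fnorm (A *m (lin f)^T) = fnorm A.
Proof. by rewrite fnorm_mulmx_orth// trmxK lin_orthC. Qed.

Section Subgroup.
Variable Gamma : subgroup (euclid_isometry R n).
Local Notation G := (subgroup_set Gamma).

Lemma subgroup1 : G 1%g.
Proof. by have [/set_mem] := subgroup_closed Gamma. Qed.

Lemma subgroup_div f g : G f -> G g -> G (f / g)%g.
Proof.
by move=> /mem_set Gf /mem_set Gg; apply: set_mem; have [_] := subgroup_closed Gamma; exact.
Qed.

Lemma subgroupV f : G f -> G (f^-1)%g.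
Proof. by move=> Gf; rewrite -[(f^-1)%g]mul1g; apply: subgroup_div Gf; exact:
  subgroup1. Qed.

Lemma subgroupM f g : G f -> G g -> G (f * g)%g.
Proof. by move=> Gf Gg; rewrite -[g]invgK; apply: subgroup_div => //; exact: subgroupV. Qed.

Lemma subgroupX f k : G f -> G (f ^+ k)%g.
Proof. by move=> Gf; elim: k => [|k ih]; rewrite ?expg0 ?expgS;
  [exact: subgroup1|exact: subgroupM]. Qed.

End Subgroup.

End Isometry.

(** * Discreteness and cocompactness in terms of norms *)

Section Topology.
Context {R : realType} {n : nat}.

Lemma ball_fnorm (x y : 'rV[R]_n) (e : R) : ball x e y -> fnorm (y - x) <= n%:R * e.
Proof.
move=> [e0 b]; have := @fnorm_le_entry R 1 n (y - x) e (ltW e0); rewrite mul1n;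
  apply => i j.
by rewrite !mxE distrC; apply/ltW; exact: b.
Qed.

Lemma fnorm_ball (x y : 'rV[R]_n) (e : R) : fnorm (y - x) < e -> ball x e y.
Proof.
move=> h; have e0 : 0 < e by rewrite (le_lt_trans _ h)// fnorm_ge0.
split=> // i j; have := le_lt_trans (entry_le_fnorm (y - x) i j) h.
by rewrite !mxE distrC.
Qed.

(** Convergence of linear and translation parts is uniform on bounded sets, hence implies
    convergence in the compact-open topology; [compact_near_covering] makes the local estimates on K
    uniform. *)
Lemma cvg_isometry1 (u : nat -> euclid_isometry R n) :
  (forall k, fnorm (lin (u k) - 1%:M) <= k.+1%:R^-1) ->
  (forall k, fnorm (tr (u k)) <= k.+1%:R^-1) -> u @ \oo --> (1%g : euclid_isometry R n).
Proof.
move=> ul ut.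
have H : (fun k => isometry_fun (u k) : {compact-open, 'rV[R]_n -> 'rV[R]_n}) @ \oo -->
    (isometry_fun (1%g : euclid_isometry R n) : {compact-open, 'rV[R]_n -> 'rV[R]_n}).
  apply/compact_open_cvgP => K O /compact_near_coveringP cK oO KO.
  have : \forall k \near \oo, K `<=` (fun x => O (u k x)).
    apply: cK => x Kx; have /(oO _)/nbhs_ballP[e /= e0 eO] : O x by apply: KO; exists x.
    pose C := fnorm x + e.
    have C0 : 0 < C by rewrite ltr_wpDl ?fnorm_ge0.
    have e3 : 0 < e / 3 by rewrite divr_gt0.
    have d0 : 0 < e / 3 / n.+1%:R by rewrite divr_gt0.
    exists (ball x (e / 3 / n.+1%:R), [set k | (Num.bound (3 * (C + 1) / e) <= k)%N]) => /=.
      by split; [exact: nbhsx_ballx|exact: nbhs_infty_ge].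
    move=> [x' k] /= [/ball_fnorm xx' Nk]; apply: eO; apply: fnorm_ball.
    have k0 : 0 < k.+1%:R :> R by [].
    have kb : (C + 1) / k.+1%:R < e / 3.
      have C1 : 0 <= C + 1 by lra.
      have h := archi_boundP (divr_ge0 (mulr_ge0 (ler0n R 3) C1) (ltW e0)).
      rewrite ltr_pdivrMr// mulrC -ltr_pdivrMr//.
      apply: le_lt_trans (lt_le_trans h (_ : _ <= k.+1%:R)); last by rewrite ler_nat ltnW.
      by rewrite invf_div mulrA [(C + 1) * 3]mulrC.
    have xx2 : fnorm (x' - x) <= e / 3.
      apply: le_trans xx' _;
        rewrite mulrCA -[leRHS]mulr1 ler_pM2l// ler_pdivrMr ?mul1r ?ler_nat//.
    have xC : fnorm x' <= C.
      rewrite -[x'](subrK x) (le_trans (fnormD _ _))// addrC lerD2l (le_trans xx2)//.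
      by rewrite ler_pdivrMr// ler_peMr ?ltW// ltr1n.
    have -> : u k x' - x = x' *m (lin (u k) - 1%:M) + tr (u k) + (x' - x).
      rewrite isometry_affine mulmxBr mulmx1; set y := x' *m _.
      by apply/rowP => j; rewrite !mxE; ring.
    have h1 : fnorm (x' *m (lin (u k) - 1%:M)) <= C / k.+1%:R.
      by rewrite (le_trans (fnormM _ _))// ler_pM ?fnorm_ge0.
    have h2 : fnorm (x' *m (lin (u k) - 1%:M)) + fnorm (tr (u k)) <= (C + 1) / k.+1%:R.
      by rewrite mulrDl lerD// mul1r.
    have h3 := le_lt_trans (le_trans (fnormD _ _) h2) kb.
    apply: le_lt_trans (fnormD _ _) _; apply: lt_le_trans (ltr_leD h3 xx2) _.
    by rewrite -mulrDl ler_pdivrMr//; move: e0 => /= ?; lra.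
  by apply: filterS => k Kk y [x Kx <-]; exact: Kk.
move=> A; rewrite nbhsE => -[B [+ B1] BA]; case=> O oO OB; subst B.
have := H O (open_nbhs_nbhs (conj oO B1)).
by apply: (@filterS nat \oo _ (fun k => O (isometry_fun (u k)))) => k Ok; apply: BA.
Qed.

(** Without such a radius, the choices 1/(k+1) would give nontrivial elements converging to 1, which
    is isolated. *)
Lemma discrete_near1 (Gamma : subgroup (euclid_isometry R n)) :
  isolated (subgroup_set Gamma) = subgroup_set Gamma ->
  exists2 rho : R, 0 < rho & forall g, subgroup_set Gamma g ->
    fnorm (lin g - 1%:M) <= rho -> fnorm (tr g) <= rho -> g = 1%g.
Proof.
move=> iso; apply/not_exists2P => H.
have /(_ _)/cid Hk k : exists g, [/\ subgroup_set Gamma g, g <> 1%g,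
    fnorm (lin g - 1%:M) <= k.+1%:R^-1 & fnorm (tr g) <= k.+1%:R^-1].
  have := H k.+1%:R^-1; rewrite invr_gt0 ltr0n /= => -[]// /existsNP[g].
  move=> /not_implyP[Gg] /not_implyP[gl] /not_implyP[gt g1].
  by exists g.
pose u k := sval (Hk k).
have uP k : [/\ subgroup_set Gamma (u k), u k <> 1%g,
    fnorm (lin (u k) - 1%:M) <= k.+1%:R^-1 & fnorm (tr (u k)) <= k.+1%:R^-1].
  exact: (svalP (Hk k)).
have u1 : u @ \oo --> (1%g : euclid_isometry R n).
  by apply: cvg_isometry1 => k; case: (uP k).
have : isolated (subgroup_set Gamma) 1%g by rewrite iso; exact: subgroup1.
move=> [_ [V V1 VG]]; have [N _ NV] := u1 _ V1.
have : (V `&` subgroup_set Gamma) (u N) by split; [apply: NV => /=|case: (uP N)].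
by rewrite VG; case: (uP N).
Qed.

Lemma pi_orbitP (Gamma : subgroup (euclid_isometry R n)) (x y : 'rV[R]_n) :
  (\pi_(orbit_space Gamma) x)%qT = (\pi_(orbit_space Gamma) y)%qT <->
  exists2 g, subgroup_set Gamma g & g x = y.
Proof.
have H : reflect ((\pi_(orbit_space Gamma) x)%qT = (\pi_(orbit_space Gamma) y)%qT)
  (same_orbit Gamma x y) by exact: (eqmodP (same_orbit_equiv Gamma) x y).
by split=> [/H/asboolP|gxy]//; apply/H/asboolP.
Qed.

(** The images of the balls of radius k about 0 form an open cover of the orbit space; a finite
    subcover bounds the distance from any point to the orbit of 0. *)
Lemma cocompact_dense (Gamma : subgroup (euclid_isometry R n)) :
  compact [set: orbit_space Gamma] ->
  exists D : R, forall x, exists2 g, subgroup_set Gamma g & fnorm (x - g 0) <= D.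
Proof.
rewrite compact_cover => /(_ nat setT).
pose U (k : nat) : set 'rV[R]_n := [set x | fnorm x < k%:R].
move=> /(_ (fun k => (\pi_(orbit_space Gamma))%qT @` U k)) [].
- move=> k _; rewrite /open/= /quotient_open openE => y [z zk /pi_orbitP[g Gg gz]].
  rewrite /interior; apply/nbhs_ballP.
  have e0 : 0 < (k%:R - fnorm z) / n.+1%:R by rewrite divr_gt0// subr_gt0.
  exists ((k%:R - fnorm z) / n.+1%:R) => //= y' /ball_fnorm yy'.
  exists ((g^-1)%g y'); last first.
    by apply/pi_orbitP; exists g => //; rewrite -isometry_mulE mulgV.
  have zE : z = (g^-1)%g y by rewrite -gz -isometry_mulE mulVg.
  rewrite /U/= -[X in fnorm X](subrK z) {1}zE (le_lt_trans (fnormD _ _))//.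
  rewrite isometry_fnorm -ltrBrDr (le_lt_trans yy')//.
  rewrite mulrCA -[ltRHS]mulr1 ltr_pM2l ?subr_gt0//.
  by rewrite ltr_pdivrMr// mul1r ltr_nat.
- move=> q _; exists (Num.bound (fnorm (repr q))) => //.
  exists (repr q); last by rewrite reprK.
  by rewrite /U/=; apply: archi_boundP; exact: fnorm_ge0.
move=> D _ cD; exists (\sum_(k <- finmap.enum_fset D) k%:R) => x.
have [k /= kD [z zk /pi_orbitP[g Gg gz]]] := cD (\pi_(orbit_space Gamma) x)%qT I.
exists g => //; rewrite -gz isometry_fnorm subr0 (le_trans (ltW zk))//.
by rewrite (big_rem k)//= lerDl sumr_ge0.
Qed.

End Topology.

(** * Bieberbach's first theorem *)

Section SmallRotations.
Context {R : realType} {n : nat}.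

Lemma orth_entry (A : 'M[R]_n) i j : A *m A^T = 1%:M -> `|A i j| <= 1.
Proof.
move=> /matrixP/(_ i i); rewrite !mxE eqxx => H.
rewrite -(@ler_pXn2r _ 2)// ?nnegrE// real_normK ?num_real// expr1n -[leRHS]H (bigD1
  j)//= mxE -expr2.
by rewrite lerDl sumr_ge0// => k _; rewrite mxE -expr2 sqr_ge0.
Qed.

(** The entries of an orthogonal matrix lie in [-1, 1]; division by 3 rather than 2 keeps the
    rescaled entries strictly below 1, as [box_eq] requires. *)
Definition obin K (A : 'M[R]_n) : 'M['I_K.+1]_n := map_mx (fun x => box K ((x + 1) / 3)) A.

Lemma obin_close (e : R) : 0 < e -> exists K : nat, forall A B : 'M[R]_n,
  A *m A^T = 1%:M -> B *m B^T = 1%:M -> obin K A = obin K B -> fnorm (A - B) <= e.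
Proof.
move=> e0; exists (Num.bound ((n * n)%:R * 3 / e)) => A B oA oB /matrixP AB.
have := archi_boundP (divr_ge0 (mulr_ge0 (ler0n R (n * n)) (ler0n R 3)) (ltW e0)).
set K := Num.bound _ => bK.
have K0 : 0 < K.+1%:R :> R by [].
have c0 : 0 <= 3 / K.+1%:R :> R by rewrite divr_ge0.
apply: le_trans (fnorm_le_entry c0 _) _ => [i j|]; last first.
  rewrite mulrA ler_pdivrMr// [leRHS]mulrC -ler_pdivrMr//.
  by rewrite ltW// (lt_le_trans bK)// ler_nat.
have b01 (C : 'M[R]_n) : C *m C^T = 1%:M -> 0 <= (C i j + 1) / 3 < 1.
  by move=> /(orth_entry i j); rewrite ler_norml => /andP[h1 h2]; apply/andP; split; lra.
have := AB i j; rewrite !mxE => /(box_eq (b01 _ oA) (b01 _ oB)).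
rewrite -mulrBl opprD addrACA subrr addr0 normrM [X in _ * X]gtr0_norm ?invr_gt0//.
by rewrite ltr_pdivrMr// mulrC => /ltW.
Qed.

(** S = A - 1 is normal, so S and S^2 have the same kernel and rank. This gives X with S = S S X^T,
    hence a lower bound for multiplication by S on its own row space. The 1 added to the norm of X^T
    makes c well defined and at most 1. *)
Lemma orth_range (A : 'M[R]_n) : A *m A^T = 1%:M ->
  exists2 c : R, 0 < c <= 1 & forall x : 'rV_n,
    c * fnorm (x *m (A - 1%:M)) <= fnorm (x *m (A - 1%:M) *m (A - 1%:M)).
Proof.
move=> AA; set S := A - 1%:M.
have kerSS : (kermx (S *m S) <= kermx S)%MS.
  apply/sub_kermxP; set Y := kermx _ *m S.
  have YS : Y *m S = 0 by rewrite /Y -mulmxA mulmx_ker.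
  have YA : Y *m A = Y by move: YS; rewrite mulmxBr mulmx1 => /eqP;
    rewrite subr_eq0 => /eqP.
  have YA' : Y *m A^T = Y by rewrite -{1}YA -mulmxA AA mulmx1.
  have SY : S *m Y^T = 0.
    by rewrite mulmxBl mul1mx -[A in A *m _]trmxK -trmx_mul YA' subrr.
  by apply: sqn_eq0; rewrite sqn_trace {1}/Y -mulmxA SY mulmx0 mxtrace0.
have rkS : (\rank S <= \rank (S *m S))%N.
  by have := mxrankS kerSS; rewrite !mxrank_ker; have := rank_leq_row S; have :=
    rank_leq_row (S *m S); lia.
have /submxP[X SX] : (S^T <= (S *m S)^T)%MS.
  have : ((S *m S)^T <= S^T)%MS by rewrite trmx_mul submxMl.
  by move=> /mxrank_leqif_sup; rewrite !mxrank_tr => -[_ <-];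
    rewrite eqn_leq rkS andbT mxrankM_maxl.
have SX' : S = S *m S *m X^T by rewrite -[LHS]trmxK SX trmx_mul trmxK.
have X0 : 0 < fnorm X^T + 1 by rewrite ltr_wpDl ?fnorm_ge0.
exists (fnorm X^T + 1)^-1 => [|x].
  by rewrite invr_gt0 X0/= invf_le1// lerDr fnorm_ge0.
rewrite mulrC ler_pdivrMr// {1}SX' mulmxA (le_trans (fnormM _ _))//.
by rewrite !mulmxA ler_wpM2l ?fnorm_ge0// lerDl.
Qed.

Variable Gamma : subgroup (euclid_isometry R n).
Local Notation G := (subgroup_set Gamma).
Variable D : R.
Hypothesis dense : forall x, exists2 g, G g & fnorm (x - g 0) <= D.

(** Take [b k] moving 0 to within D of K^(k+1) u, and i < j for which the linear parts of [b i] and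
    [b j] share a box. In [b j / b i] the translation error is at most 2 D + K^j, and K was chosen
    with 2 D + 1 <= e K, so it is at most e K^(j+1). *)
Lemma almost_translation (u : 'rV[R]_n) (e : R) : fnorm u = 1 -> 0 < e ->
  exists g (t : R), [/\ G g, 0 < t, fnorm (lin g - 1%:M) <= e & fnorm (tr g - t *: u)
    <= e * t].
Proof.
move=> u1 e0.
have D0 : 0 <= D by have [g _] := dense 0; apply: le_trans; exact: fnorm_ge0.
pose K := (2 * D + 1) / e + 1.
have K1 : 1 <= K by rewrite lerDr; apply: divr_ge0; [lra|exact: ltW].
have Ke : 2 * D + 1 <= e * K.
  by rewrite mulrDr mulrCA mulfV ?gt_eqF// !mulr1 lerDl ltW.
have /choice[b bP] k : exists g, G g /\ fnorm (K ^+ k.+1 *: u - tr g) <= D.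
  by have [g Gg gD] := dense (K ^+ k.+1 *: u); exists g.
have [N NP] := obin_close e0.
have [i [j [ij _ eqb]]] := pigeonhole_nat (fun k => obin N (lin (b k))).
have {}NP := NP _ _ (lin_orth (b i)) (lin_orth (b j)) eqb.
have [[Gi bi] [Gj bj]] := (bP i, bP j).
exists (b j / b i)%g, (K ^+ j.+1); split.
- exact: subgroup_div.
- by rewrite exprn_gt0// (lt_le_trans _ K1).
- rewrite linM linV -(lin_orthC (b i)) -mulmxBr fnorm_orth_mulmx 1?fnormB//.
  by rewrite trmxK lin_orth.
rewrite trM trV mulNmx -addrA addrC.
have Kj : 1 <= K ^+ j by rewrite exprn_ege1.
have Kij : K ^+ i.+1 <= K ^+ j by rewrite ler_weXn2l.
have h1 : fnorm (tr (b i)) <= D + K ^+ j.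
  rewrite -[tr _](subrK (K ^+ i.+1 *: u)) (le_trans (fnormD _ _))// fnormB lerD//.
  by rewrite fnormZ u1 mulr1 ger0_norm// exprn_ge0// (le_trans _ K1).
rewrite (le_trans (fnormD _ _))// fnormN fnorm_lin fnorm_lin_tr fnormB.
have h2 : (2 * D + 1) * K ^+ j <= e * K ^+ j.+1.
  by rewrite exprS mulrA ler_wpM2r// (le_trans _ Kj).
have h3 : 2 * D <= 2 * D * K ^+ j by rewrite ler_peMr// mulr_ge0.
rewrite mulrDl mul1r in h2; lra.
Qed.

(** For [g] with linear part near 1, taking the commutator with [f] acts on translation parts nearly
    as [S]. The first estimate rests on B A - A B = (B - 1) S - S (B - 1). *)
Lemma commutator_lin_tr (f g : euclid_isometry R n) (S := lin f - 1%:M) :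
  let h := (f * g / f / g)%g in
  fnorm (lin h - 1%:M) <= 2 * fnorm S * fnorm (lin g - 1%:M) /\
  fnorm (tr h - tr g *m S) <=
    fnorm (lin h - 1%:M) * fnorm (tr g) + fnorm (lin g - 1%:M) * fnorm (tr f).
Proof.
move=> h; set A := lin f in S *; set B := lin g.
have AA : A *m A^T = 1%:M by exact: lin_orth.
have AA' : A^T *m A = 1%:M by exact: lin_orthC.
have BB' : B^T *m B = 1%:M by exact: lin_orthC.
have linh : lin h = B^T *m (A^T *m (B *m A)) by rewrite /h !linM !linV.
split.
  have -> : lin h - 1%:M = B^T *m A^T *m (B *m A - A *m B).
    rewrite linh mulmxBr -!mulmxA; congr (_ - _).
    by rewrite (mulmxA A^T) AA' mul1mx BB'.
  rewrite -mulmxA !fnorm_orth_mulmx ?trmxK//; try exact: lin_orth.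
  have -> : B *m A - A *m B = (B - 1%:M) *m S - S *m (B - 1%:M).
    rewrite /S !mulmxBl !mulmxBr !mulmx1 !mul1mx.
    set BA := B *m A; set AB := A *m B; apply/matrixP => i j; rewrite !mxE; ring.
  rewrite (le_trans (fnormD _ _))// fnormN.
  have := fnormM (B - 1%:M) S; have := fnormM S (B - 1%:M).
  rewrite [fnorm S * _]mulrC => h1 h2; rewrite -mulrA [fnorm S * _]mulrC mulr_natl mulr2n.
  exact: lerD.
have -> : tr h - tr g *m S = tr g *m (1%:M - lin h) + tr f *m A^T *m (1%:M - B) *m A.
  rewrite linh /h !trM !trV !linM !linV -/A -/B /S !(mulmxBr, mulmxBl) !mulmx1 !mulNmx
    !mulmxA.
  rewrite -[X in _ + (X - _)]mulmxA AA' mulmx1.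
  set x1 := _ *m B *m A; set x2 := tr f *m _ *m _ *m _; set x3 := tr g *m A.
  apply/matrixP => i j; rewrite !mxE; ring.
rewrite (le_trans (fnormD _ _))// lerD//.
  by rewrite (le_trans (fnormM _ _))// mulrC fnormB.
rewrite fnorm_mulmx_orth// (le_trans (fnormM _ _))// mulrC fnormB fnorm_mulmx_orth//.
by rewrite trmxK.
Qed.

Variable rho : R.
Hypothesis rho0 : 0 < rho.
Hypothesis near1 : forall g, G g -> fnorm (lin g - 1%:M) <= rho ->
  fnorm (tr g) <= rho -> g = 1%g.

(* If the linear part A of g is close but not equal to 1, start with an element
   of linear part almost 1 that translates approximately in a direction of the
   range of A - 1. Iterated commutators with g apply A - 1 to the translation
   part up to a small error; this part shrinks but never vanishes, which
   contradicts discreteness. *)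
Lemma small_rotation_trivial g : G g -> fnorm (lin g - 1%:M) <= 4^-1 -> lin g = 1%:M.
Proof.
move=> Gg g4; apply/eqP; rewrite -subr_eq0 -[_ == 0]negbK; apply/negP => S0.
set S := lin g - 1%:M in g4 S0.
have [c /andP[c0 c1] cS] := orth_range (lin_orth g).
rewrite -/S in cS.
pose M := fnorm (tr g) / rho.
have M0 : 0 <= M by rewrite divr_ge0 ?fnorm_ge0// ltW.
(* The three bounds serve, in order, to apply [near1], to keep the starting element close enough to
   the direction u, and to make the commutator error at most c^2/16 times the norm of [tr b]. *)
pose e := Num.min rho (Num.min (c / 8) (c ^+ 2 / 16 / (1 + M))).
have M1 : 0 < 1 + M by rewrite ltr_pwDl.
have e0 : 0 < e by rewrite !lt_min rho0 !divr_gt0// exprn_gt0.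
have e_rho : e <= rho by rewrite ge_min lexx.
have e_c : e <= c / 8 by rewrite !ge_min lexx orbT.
have e_M : e * (1 + M) <= c ^+ 2 / 16.
  by rewrite -ler_pdivlMr// !ge_min lexx !orbT.
have [i ri0] : exists i, row i S != 0.
  apply/existsP; rewrite -negb_forall; apply: contra S0 => /forallP H.
  by apply/eqP/row_matrixP => i; rewrite row0; apply/eqP.
pose u := (fnorm (row i S))^-1 *: row i S.
have ri_gt0 : 0 < fnorm (row i S).
  by rewrite lt_neqAle fnorm_ge0 andbT eq_sym; apply: contra_neq ri0; exact: fnorm_eq0.
have u1 : fnorm u = 1 by rewrite fnormZ ger0_norm ?invr_ge0 ?ltW// mulVf// gt_eqF.
(* The last clause keeps [tr b] near the row space of S, where [orth_range] bounds multiplication by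
   S from below. *)
pose good b := [/\ G b, fnorm (lin b - 1%:M) <= e, 0 < fnorm (tr b) &
  exists y, fnorm (tr b - y *m S) <= c / 4 * fnorm (tr b)].
have not_small b : good b -> rho < fnorm (tr b).
  move=> [Gb be b0 _]; rewrite ltNge; apply/negP => brho.
  have b1 := near1 Gb (le_trans be e_rho) brho.
  by move: b0; rewrite b1 tr1 fnorm0 ltxx.
have step b : good b -> exists2 b', good b' & fnorm (tr b') <= 3 / 4 * fnorm (tr b).
  move=> gb; have brho := not_small b gb; case: gb => Gb be b0 [y by_].
  have [h1 h2] := commutator_lin_tr g b; set b' := (_ / _)%g in h1 h2.
  rewrite -/S in h1 h2.
  have b'e : fnorm (lin b' - 1%:M) <= e / 2.
    apply: (le_trans h1); rewrite -mulrA; have : fnorm S * fnorm (lin b - 1%:M) <= 4^-1 * e.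
      by rewrite ler_pM ?fnorm_ge0.
    lra.
  have b'e' : fnorm (lin b' - 1%:M) <= e by lra.
  have gM : fnorm (tr g) <= M * fnorm (tr b).
    by rewrite /M mulrAC ler_pdivlMr// ler_wpM2l ?fnorm_ge0// ltW.
  have r1 : fnorm (tr b' - tr b *m S) <= c ^+ 2 / 16 * fnorm (tr b).
    apply: (le_trans h2); apply: (@le_trans _ _ (e * (1 + M) * fnorm (tr b))); last first.
      by rewrite ler_wpM2r// fnorm_ge0.
    rewrite mulrDr mulr1 mulrDl lerD//; first by rewrite ler_wpM2r ?fnorm_ge0.
    by rewrite -mulrA ler_pM ?fnorm_ge0.
  have r2 : fnorm (tr b *m S) <= 4^-1 * fnorm (tr b).
    by rewrite (le_trans (fnormM _ _))// mulrC ler_wpM2r ?fnorm_ge0.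
  pose s := tr b - y *m S.
  have bE : tr b = y *m S + s by rewrite addrC subrK.
  have sS : fnorm (s *m S) <= 4^-1 * (c / 4 * fnorm (tr b)).
    by rewrite (le_trans (fnormM _ _))// mulrC ler_pM ?fnorm_ge0.
  have yS : (1 - c / 4) * fnorm (tr b) <= fnorm (y *m S).
    have := fnormD (y *m S) s; rewrite -bE mulrBl mul1r; rewrite -/s in by_; lra.
  have cb0 : 0 < c * fnorm (tr b) by rewrite mulr_gt0.
  have bS : c / 2 * fnorm (tr b) <= fnorm (tr b *m S).
    rewrite {2}bE mulmxDl; apply: le_trans (fnormD_ge _ _).
    have := cS y; have : c * ((1 - c / 4) * fnorm (tr b)) <= c * fnorm (y *m S) by
      rewrite ler_pM2l.
    have : c * c * fnorm (tr b) <= c * fnorm (tr b) by rewrite ler_pM2r// ger_pMr.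
    by move: sS; lra.
  have cc : c ^+ 2 <= c by rewrite expr2 ger_pMr.
  have cb : c ^+ 2 * fnorm (tr b) <= c * fnorm (tr b) by rewrite ler_pM2r.
  have cb1 : c * fnorm (tr b) <= fnorm (tr b) by rewrite ger_pMl.
  have b'E : tr b' = tr b *m S + (tr b' - tr b *m S) by rewrite addrC subrK.
  have lower : c / 4 * fnorm (tr b) <= fnorm (tr b').
    by rewrite b'E; apply: le_trans (fnormD_ge _ _); lra.
  exists b'.
    split=> //; first by do 2![apply: subgroup_div => //]; exact: subgroupM.
      by apply: lt_le_trans lower; rewrite mulr_gt0// divr_gt0.
    (* The new translation part is close to [tr b *m S], so the old one witnesses its nearness to
       the row space. *)
    exists (tr b); apply: (le_trans r1).
    have : c / 4 * (c / 4 * fnorm (tr b)) <= c / 4 * fnorm (tr b') by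
      rewrite ler_pM2l// divr_gt0.
    by rewrite expr2; lra.
  by rewrite b'E (le_trans (fnormD _ _))//; lra.
(* Since the norm of [tr b] exceeds rho, contraction by 3/4 lowers it by more than rho/4, which can
   happen only finitely often. *)
have contra k : forall b, good b -> fnorm (tr b) <= rho + k%:R * (rho / 4) -> False.
  elim: k => [|k ih] b gb.
    by rewrite mul0r addr0 leNgt not_small.
  have brho := not_small b gb; have [b' gb' b'b] := step b gb.
  move=> bk; apply: (ih b' gb'); rewrite -natr1 mulrDl mul1r in bk; lra.
have e1 : 0 < e by [].
have [b [t [Gb t0 be bt]]] := almost_translation u1 e1.
have tb : t - e * t <= fnorm (tr b).
  have -> : tr b = t *: u + (tr b - t *: u) by rewrite addrC subrK.
  apply: le_trans (fnormD_ge _ _); rewrite fnormZ u1 mulr1 gtr0_norm//.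
  by rewrite lerB.
have et : e * t <= c / 8 * t by rewrite ler_pM2r.
have ct : c * t <= t by rewrite ger_pMl.
have gb : good b.
  split=> //; first by lra.
  exists ((t / fnorm (row i S)) *: delta_mx 0 i).
  rewrite -scalemxAl -rowE -scalerA -/u; apply: (le_trans bt).
  have : c / 4 * (t - e * t) <= c / 4 * fnorm (tr b) by rewrite ler_pM2l// divr_gt0.
  have et0 : 0 < e * t by rewrite mulr_gt0.
  have : c * (e * t) <= e * t by rewrite ger_pMl.
  lra.
apply: (contra (Num.bound (fnorm (tr b) / (rho / 4))) b gb).
have r4 : 0 < rho / 4 by rewrite divr_gt0.
have := archi_boundP (divr_ge0 (fnorm_ge0 (tr b)) (ltW r4)).
by rewrite ltr_pdivrMr// => /ltW h; rewrite (le_trans h)// lerDr ltW.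
Qed.

End SmallRotations.

(** * Translation lattices and holonomy *)

Section TranslationLattice.
Context {R : realType}.

Definition translations n (H : subgroup (euclid_isometry R n)) : set 'rV[R]_n :=
  [set b | exists g, [/\ subgroup_set H g, lin g = 1%:M & tr g = b]].

Lemma translation_mem n (H : subgroup (euclid_isometry R n)) g : lin g = 1%:M ->
  translations H (tr g) <-> subgroup_set H g.
Proof.
move=> g1; split=> [[h [Hh h1 hg]]|Hg]; last by exists g.
by rewrite -(isometry_eq (etrans h1 (esym g1)) hg).
Qed.

Lemma translations_zmod n (H : subgroup (euclid_isometry R n)) : zmod_set (translations H).
Proof.
split; first by exists 1%g; rewrite lin1 tr1; split=> //; exact: subgroup1.
move=> _ _ [g [Hg g1 <-]] [h [Hh h1 <-]]; exists (g / h)%g; split.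
- exact: subgroup_div.
- by rewrite linM linV g1 h1 trmx1 mulmx1.
- by rewrite trM trV g1 h1 trmx1 !mulmx1 addrC.
Qed.

Lemma discrete_dense n (Gamma : subgroup (euclid_isometry R n)) : space_group Gamma ->
  (exists2 rho : R, 0 < rho & forall g, subgroup_set Gamma g ->
    fnorm (lin g - 1%:M) <= rho -> fnorm (tr g) <= rho -> g = 1%g) /\
  exists D : R, forall x, exists2 g, subgroup_set Gamma g & fnorm (x - g 0) <= D.
Proof. by move=> [/discrete_near1 ? /cocompact_dense]. Qed.

(* The linear parts are pairwise at distance more than 1/4 in the orthogonal
   group, so their number is bounded in terms of n only. *)
Lemma holonomy_reps n : exists M : nat, forall Gamma : subgroup (euclid_isometry R n),
  space_group Gamma -> exists (I : finType) (rep : I -> euclid_isometry R n),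
    [/\ (#|I| <= M)%N, forall i, subgroup_set Gamma (rep i), injective (lin \o rep) &
        forall g, subgroup_set Gamma g -> exists i, lin (rep i) = lin g].
Proof.
have [//|K KP] := @obin_close R n 4^-1.
exists #|'M['I_K.+1]_n| => Gamma sG; have [[rho rho0 near1] [D dense]] := discrete_dense sG.
pose P (m : 'M['I_K.+1]_n) := `[< exists g, subgroup_set Gamma g /\ obin K (lin g) = m >].
have exP (i : {m | P m}) : exists g, subgroup_set Gamma g /\ obin K (lin g) = val i.
  by apply/asboolP; exact: valP i.
have [rep repP] := choice exP.
exists {m | P m}, rep; split.
- by rewrite card_sig max_card.
- by move=> i; case: (repP i).
- move=> i j /= ij; apply: val_inj.
  by case: (repP i) => _ <-; case: (repP j) => _ <-; rewrite ij.
move=> g Gg; have Pg : P (obin K (lin g)) by apply/asboolP; exists g.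
pose i : {m | P m} := exist _ (obin K (lin g)) Pg.
exists i; have [Gi iE] := repP i.
have close := KP _ _ (lin_orth (rep i)) (lin_orth g) iE.
have : lin (rep i / g)%g = 1%:M.
  apply: (small_rotation_trivial dense rho0 near1); first exact: subgroup_div.
  rewrite linM linV -(lin_orthC g) -mulmxBr fnorm_orth_mulmx//.
  by rewrite trmxK lin_orth.
rewrite linM linV => /(congr1 (mulmx (lin g))).
by rewrite mulmxA lin_orth mul1mx mulmx1.
Qed.

Lemma translations_discrete n (Gamma : subgroup (euclid_isometry R n)) :
  space_group Gamma -> discrete_set (translations Gamma).
Proof.
move=> /discrete_dense[[rho rho0 near1] _].
have r0 : 0 < rho / n.+1%:R by rewrite divr_gt0.
exists (rho / n.+1%:R) => // _ [g [Gg g1 <-]] small.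
rewrite (near1 g) ?tr1//; first by rewrite g1 subrr fnorm0 ltW.
apply: le_trans (fnorm_le_entry (ltW r0) _) _ => [i j|].
  by rewrite ord1 ltW.
rewrite mul1n mulrCA -[leRHS]mulr1 ler_pM2l// ler_pdivrMr// mul1r ler_nat//.
Qed.

(** Correcting by one of finitely many representatives shows that translations come within D' of
    every point. Approximating large multiples of the standard basis gives, after rescaling, a
    matrix near 1, which is invertible. *)
Lemma translations_span n (Gamma : subgroup (euclid_isometry R n)) : space_group Gamma ->
  exists2 E : 'M[R]_n, E \in unitmx & forall i, translations Gamma (row i E).
Proof.
move=> sG; have [_ [D dense]] := discrete_dense sG.
have [M /(_ Gamma sG)[I [rep [_ Grep _ repP]]]] := holonomy_reps n.
pose D' := D + \sum_i fnorm (tr (rep i)).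
have Tdense x : exists t, translations Gamma t /\ fnorm (x - t) <= D'.
  have [g Gg gD] := dense x; have [i ig] := repP g Gg.
  have g1 : lin (g / rep i)%g = 1%:M by rewrite linM linV ig lin_orthC.
  exists (tr (g / rep i)%g); split.
    by apply/translation_mem => //; exact: subgroup_div.
  rewrite trM trV mulNmx -mulmxA ig lin_orthC mulmx1 opprD opprK addrCA addrC.
  rewrite (le_trans (fnormD _ _))// lerD// (bigD1 i)//= lerDl sumr_ge0// => j _.
  exact: fnorm_ge0.
have D'0 : 0 <= D' by have [t [_]] := Tdense 0; apply: le_trans; exact: fnorm_ge0.
(* [(n * n)%:R * D'] bounds the norm of [E - a%:M] below, so after division by a the distance to 1
   is less than 1. *)
pose a := (n * n)%:R * D' + 1.
have a0 : 0 < a by rewrite ltr_wpDl// mulr_ge0.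
have [f fP] := choice (fun i => Tdense (a *: delta_mx 0 i)).
pose E := \matrix_i f i.
have uE : a^-1 *: E \in unitmx.
  apply: unitmx_near1; have -> : a^-1 *: E - 1%:M = a^-1 *: (E - a%:M).
    by rewrite scalerBr scale_scalar_mx mulVf// gt_eqF.
  rewrite fnormZ ger0_norm ?invr_ge0 ?ltW// mulrC ltr_pdivrMr// mul1r.
  apply: le_lt_trans (fnorm_le_entry D'0 _) _ => [i j|]; last by rewrite ltrDl.
  have [_] := fP i; apply: le_trans.
  rewrite fnormB; have := entry_le_fnorm (f i - a *: delta_mx 0 i) 0 j.
  by rewrite !mxE eqxx /= mulr_natr eq_sym.
exists E => [|i]; last by rewrite rowK; case: (fP i).
by move: uE; rewrite unitmxZ// unitfE invr_eq0 gt_eqF.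
Qed.

Lemma translations_lin n (Gamma H : subgroup (euclid_isometry R n)) g x :
  normal_subgroup H Gamma -> subgroup_set Gamma g -> translations H x ->
  translations H (x *m lin g).
Proof.
move=> [_ nH] Gg [t [Ht t1 <-]].
exists (t ^ (g^-1))%g; split; first by apply: nH => //; exact: subgroupV.
- by rewrite conjgE invgK !linM t1 mulmx1 linV lin_orthC.
- rewrite conjgE invgK !trM trV t1 mulmx1 mulmxDl mulNmx -mulmxA lin_orthC mulmx1.
  by rewrite addrC addrA subrr add0r.
Qed.

Lemma normal_subgroup_refl n (H : subgroup (euclid_isometry R n)) : normal_subgroup H H.
Proof.
split=> // g x Hg Hx; rewrite conjgE.
by do 2?[apply: subgroupM] => //; exact: subgroupV.
Qed.

(** The displacement at y is y (lin f - 1) + tr f. If some row i of lin f - 1 were nonzero, the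
    multiple [s] of the i-th basis vector would be displaced by at least C + 1. *)
Lemma bounded_displacement n (f : euclid_isometry R n) (C : R) :
  (forall y, fnorm (f y - y) <= C) -> lin f = 1%:M.
Proof.
move=> fC; apply/eqP; rewrite -subr_eq0 -[_ == 0]negbK; apply/negP => S0.
have [i ri0] : exists i, row i (lin f - 1%:M) != 0.
  apply/existsP; rewrite -negb_forall; apply: contra S0 => /forallP H.
  by apply/eqP/row_matrixP => i; rewrite row0; apply/eqP.
have ri_gt0 : 0 < fnorm (row i (lin f - 1%:M)).
  by rewrite lt_neqAle fnorm_ge0 andbT eq_sym; apply: contra_neq ri0; exact: fnorm_eq0.
set d := fnorm _ in ri_gt0; pose s := (C + fnorm (tr f) + 1) / d.
have C0 : 0 <= C by apply: le_trans (fC 0); exact: fnorm_ge0.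
have := fC (s *: delta_mx 0 i); rewrite isometry_affine.
have -> : s *: delta_mx 0 i *m lin f + tr f - s *: delta_mx 0 i =
    s *: row i (lin f - 1%:M) + tr f.
  by rewrite rowE mulmxBr mulmx1 scalerBr scalemxAl addrAC.
apply/negP; rewrite -ltNge; apply: lt_le_trans (fnormD_ge _ _).
have s0 : 0 <= s by rewrite divr_ge0 ?addr_ge0 ?fnorm_ge0 ?(ltW ri_gt0).
rewrite fnormZ ger0_norm// -/d /s divfK ?gt_eqF//; lra.
Qed.

End TranslationLattice.

(** * Quotients that are space groups *)

Section SpaceGroupQuotient.
Context {R : realType} {n : nat}.
Implicit Types (Gamma N : subgroup (euclid_isometry R n)).

Lemma coset_mulE Gamma N g h : normal_subgroup N Gamma -> subgroup_set Gamma g ->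
  subgroup_set Gamma h ->
  ([set g * x | x in subgroup_set N] * [set h * x | x in subgroup_set N])%g =
  [set (g * h * x)%g | x in subgroup_set N].
Proof.
move=> [NG nN] Gg Gh; apply/seteqP; split=> [_ [_ [x Nx <-]] [_ [y Ny <-]] <-|_ [x Nx <-]].
  exists (x ^ h * y)%g; first by apply: subgroupM => //; exact: nN.
  by rewrite conjgE !mulgA mulgK.
exists g; first by exists 1%g; rewrite ?mulg1//; exact: subgroup1.
exists (h * x)%g; first by exists x.
by rewrite mulgA.
Qed.

(** Composing with the projection turns an isomorphism on cosets into a surjective morphism on Gamma
    with kernel N, which spares later arguments the cosets. *)
Lemma quotient_morphism Gamma N k (Delta : subgroup (euclid_isometry R k)) :
  normal_subgroup N Gamma -> group_isomorphic (quotient_group Gamma N) Delta ->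
  exists h : euclid_isometry R n -> euclid_isometry R k,
  [/\ forall x y, subgroup_set Gamma x -> subgroup_set Gamma y -> h (x * y)%g = (h x *
    h y)%g,
      forall x, subgroup_set Gamma x -> h x = 1%g <-> subgroup_set N x,
      forall x, subgroup_set Gamma x -> subgroup_set Delta (h x) &
      forall y, subgroup_set Delta y -> exists2 x, subgroup_set Gamma x & h x = y].
Proof.
move=> nN [f [[fD finj fsurj] fM]].
pose coset g : set (euclid_isometry R n) := [set (g * x)%g | x in subgroup_set N].
have cosetQ g : subgroup_set Gamma g -> quotient_group Gamma N (coset g) by move=> Gg;
  exists g.
have hM x y : subgroup_set Gamma x -> subgroup_set Gamma y ->
    f (coset (x * y)%g) = (f (coset x) * f (coset y))%g.
  by move=> Gx Gy; rewrite -fM; [rewrite (coset_mulE nN)| exact: cosetQ | exact: cosetQ].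
have G1 := subgroup1 Gamma.
have h1 : f (coset 1%g) = 1%g.
  have := hM _ _ G1 G1; rewrite mulg1 => H.
  by apply: (@mulgI _ (f (coset 1%g))); rewrite -H mulg1.
exists (f \o coset); split=> //= [x Gx|x Gx|y Dy].
- split=> [hx|Nx].
    have : coset x = coset 1%g.
      by apply: finj; rewrite ?inE; [exact: cosetQ|exact: cosetQ|rewrite h1].
    move=> /seteqP[+ _] => /(_ x); case.
      by exists 1%g; rewrite ?mulg1//; exact: subgroup1.
    by move=> y Ny; rewrite mul1g => <-.
  rewrite -h1; congr f; apply/seteqP; split=> [_ [y Ny <-]|_ [y Ny <-]].
    by exists (x * y)%g; rewrite ?mul1g//; exact: subgroupM.
  exists (x^-1 * y)%g; first by apply: subgroupM => //; exact: subgroupV.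
  by rewrite mulVKg mul1g.
- exact: fD (cosetQ x Gx).
- by have [A [g Gg <-] fA] := fsurj y Dy; exists g.
Qed.

(* An element of a space group that commutes with a subgroup of finite index has
   bounded displacement, hence is a translation; if it also has finite order it
   is trivial. So the elements of Gamma whose image in Gamma / N has finite order
   and commutes with the image of the translations are exactly those of N. *)
Lemma normal_char Gamma N g : space_group Gamma -> normal_subgroup N Gamma ->
  space_group_quotient R Gamma N ->
  subgroup_set N g <-> [/\ subgroup_set Gamma g,
    exists k, [/\ (0 < k)%N, lin (g ^+ k)%g = 1%:M & translations N (tr (g ^+ k)%g)] &
    forall x, translations Gamma x -> translations N (x *m lin g - x)].
Proof.
move=> sG nN [d [Delta [sD isoD]]]; case: (nN) => NG nNx.
have [M /(_ _ sG)[I [rep [_ Grep repinj repP]]]] := holonomy_reps (R := R) n.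
have comm_tr x t : subgroup_set Gamma t -> lin t = 1%:M -> subgroup_set Gamma x ->
    lin (x * t / x / t)%g = 1%:M /\ tr (x * t / x / t)%g = tr t *m lin x - tr t.
  move=> Gt t1 Gx.
  have l1 : lin (x * t / x)%g = 1%:M by rewrite !linM linV t1 mul1mx lin_orthC.
  have -> : tr (x * t / x / t)%g = tr (x * t / x)%g - tr t.
    by rewrite trM l1 trV t1 trmx1 !mulmx1 addrC.
  split; first by rewrite linM linV t1 l1 trmx1 mulmx1.
  congr (_ - _); rewrite !trM trV linM t1 mul1mx mulNmx -mulmxA lin_orthC mulmx1.
  by rewrite addrC addrK.
split=> [Ng|[Gg [k [k0 gk1 Ngk]] Ncomm]].
  have Gg := NG _ Ng; split=> //.
  - have /choice[s sP] k : exists i, lin (rep i) = lin (g ^+ k)%g.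
      by apply: repP; exact: subgroupX.
    have [a [b [ab _ sab]]] := pigeonhole_nat s.
    have gab : lin (g ^+ (b - a))%g = 1%:M.
      have : lin (g ^+ b)%g = lin (g ^+ a)%g by rewrite -!sP sab.
      rewrite -{1}(subnK (ltnW ab)) expgnDr linM => /(congr1 (mulmx (lin (g ^+ a)%g)^T)).
      by rewrite mulmxA lin_orthC mul1mx.
    exists (b - a)%N; rewrite subn_gt0; split=> //.
    by apply/translation_mem => //; exact: subgroupX.
  - move=> _ [t [Gt t1 <-]]; have [c1 <-] := comm_tr g t Gt t1 Gg.
    apply/translation_mem => //.
    (* The commutator is the product of [g] and a conjugate of its inverse, both in N. *)
    have -> : (g * t / g / t = g * (g^-1 ^ t^-1))%g by rewrite conjgE invgK !mulgA.
    by apply: subgroupM => //; apply: nNx; exact: subgroupV.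
have [h [hM hker hD hsurj]] := quotient_morphism nN isoD.
apply/hker => //; set f := h g.
have Gm := subgroupM; have G1 := subgroup1 Gamma.
have h1 : h 1%g = 1%g by apply/hker => //; exact: subgroup1.
have hX j : h (g ^+ j)%g = (f ^+ j)%g.
  elim: j => [|j ih]; first by rewrite !expg0.
  by rewrite !expgS hM ?ih//; exact: subgroupX.
have fk : (f ^+ k)%g = 1%g.
  by rewrite -hX; apply/hker; [exact: subgroupX|exact/translation_mem].
have fcomm t : subgroup_set Gamma t -> lin t = 1%:M -> (f * h t = h t * f)%g.
  move=> Gt t1; have [c1 c2] := comm_tr g t Gt t1 Gg.
  have Nc : subgroup_set N (g * t / g / t)%g.
    by apply/translation_mem => //; rewrite c2; apply: Ncomm; exists t.
  have Gc := NG _ Nc.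
  have : (g * t = (g * t / g / t) * (t * g))%g by rewrite !mulgA mulgVK mulgVK.
  move=> /(congr1 h); rewrite hM// => ->; rewrite hM//; last exact: subgroupM.
  by rewrite (hker _ Gc).2// mul1g hM.
have [_ [D dense]] := discrete_dense sD.
pose p i := h (rep i) 0.
(* Some [h t (p i)] with t a translation lies within D of y. As f commutes with [h t], its
   displacement there equals that at [p i], and there are finitely many [p i]. *)
have fdisp y : fnorm (f y - y) <= D + D + \sum_i fnorm (f (p i) - p i).
  have [_ /hsurj[x Gx <-] yD] := dense y.
  have [i ix] := repP x Gx; pose t := (x / rep i)%g.
  have Gt : subgroup_set Gamma t by exact: subgroup_div.
  have t1 : lin t = 1%:M by rewrite linM linV ix lin_orthC.
  have hx : h x 0 = h t (p i) by rewrite /p -isometry_mulE -hM// /t mulgVK.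
  rewrite hx in yD.
  have -> : f y - y = (f y - f (h t (p i))) + (h t (p i) - y) + (h t (f (p i)) - h t (p i)).
    rewrite -[h t (f _)]isometry_mulE -fcomm// isometry_mulE.
    set a := f (h t _); set b := h t _; apply/matrixP => ? ?; rewrite !mxE; ring.
  have i1 : fnorm (f (p i) - p i) <= \sum_i fnorm (f (p i) - p i).
    by rewrite (bigD1 i)//= lerDl sumr_ge0// => j _; exact: fnorm_ge0.
  rewrite (le_trans (fnormD _ _))// lerD//; last by rewrite isometry_fnorm.
  by rewrite (le_trans (fnormD _ _))// lerD// ?isometry_fnorm// fnormB.
have f1 := bounded_displacement fdisp.
apply: isometry_eq; rewrite ?lin1// tr1.
have fX j : lin (f ^+ j)%g = 1%:M /\ tr (f ^+ j)%g = tr f *+ j.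
  elim: j => [|j [l t]]; first by rewrite expg0 lin1 tr1.
  by rewrite expgS linM trM l f1 mulmx1 t mulmx1 mulrS addrC.
have [_] := fX k; rewrite fk tr1 => /esym/eqP.
by rewrite -scaler_nat scaler_eq0 pnatr_eq0 eqn0Ngt k0/= => /eqP.
Qed.

(** Translations commute, so the commutator condition of [normal_char] is automatic and one power in
    N suffices. *)
Lemma translations_pure Gamma N x k : space_group Gamma -> normal_subgroup N Gamma ->
  space_group_quotient R Gamma N ->
  translations Gamma x -> (0 < k)%N -> translations N (x *+ k) -> translations N x.
Proof.
move=> sG nN sQ [t [Gt t1 tx]] k0 Nxk.
rewrite -tx; apply/translation_mem => //; apply/(normal_char t sG nN sQ); split=> //.
- exists k; have fX j : lin (t ^+ j)%g = 1%:M /\ tr (t ^+ j)%g = tr t *+ j.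
    elim: j => [|j [l u]]; first by rewrite expg0 lin1 tr1.
    by rewrite expgS linM trM l t1 mulmx1 u mulmx1 mulrS addrC.
  by have [-> ->] := fX k; rewrite tx.
- by move=> y _; rewrite t1 mulmx1 subrr; exact: (translations_zmod N).1.
Qed.

End SpaceGroupQuotient.

(** * Coordinates adapted to a pair *)

Section StandardCoordinates.
Context {R : realType} {n : nat}.
Implicit Types (Gamma N : subgroup (euclid_isometry R n)).

Definition vanishes_from r (z : 'rV[R]_n) := forall j : 'I_n, (r <= j)%N -> z 0 j = 0.

Lemma vanishes_mul r z (P : 'M[R]_n) : lower_block r P -> vanishes_from r z ->
  vanishes_from r (z *m P).
Proof.
move=> lP zr j rj; rewrite mxE big1// => k _.
have [kr|rk] := ltnP k r; first by rewrite lP// mulr0.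
by rewrite zr// mul0r.
Qed.

(** The rows of E form a Z-basis of the translation lattice of Gamma whose first r members form a
    basis of that of N. *)
Definition adapted (E : 'M[R]_n) r Gamma N := [/\ (r <= n)%N, E \in unitmx,
  forall x, translations Gamma x <-> x *m invmx E \is a intmx &
  forall x, translations N x <-> x *m invmx E \is a intmx /\ vanishes_from r (x *m
    invmx E)].

Lemma adapted_exists Gamma N : space_group Gamma -> normal_subgroup N Gamma ->
  space_group_quotient R Gamma N -> exists r E, adapted E r Gamma N.
Proof.
move=> sG nN sQ; have [E0 uE0 TE0] := translations_span sG.
have [||r [E [rn uE TE LE]]] :=
  adapted_basis (translations_zmod Gamma) (translations_discrete sG)
    uE0 TE0 (translations_zmod N).
- by move=> x [g [Ng g1 gx]]; exists g; split=> //; case: nN => NG _; exact: NG.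
- by move=> x k; exact: translations_pure.
by exists r, E.
Qed.

Lemma adapted_action E r Gamma N (I : finType) (rep : I -> euclid_isometry R n) :
  normal_subgroup N Gamma -> adapted E r Gamma N ->
  (forall i, subgroup_set Gamma (rep i)) -> injective (lin \o rep) ->
  (forall g, subgroup_set Gamma g -> exists i, lin (rep i) = lin g) ->
  let rho i := E *m lin (rep i) *m invmx E in
  (exists mul inv, mx_action mul inv rho) /\ forall i, lower_block r (rho i).
Proof.
move=> nN [rn uE TE LE] Grep repinj repP rho.
have rowT k : translations Gamma (row k E).
  apply/TE; rewrite -row_mul mulmxV//; apply/mxOverP => a b; rewrite !mxE; exact: rpred_nat.
have rhoinj i j : rho i = rho j -> i = j.
  move=> ij; apply: repinj => /=; apply: (can_inj (mulKmx uE)).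
  by apply: (can_inj (mulmxK (_ : invmx E \in unitmx))); rewrite ?unitmx_inv.
have [mul mulP] : exists mul, forall ij : I * I, rho (mul ij) = rho ij.1 *m rho ij.2.
  suff /choice[m mP] : forall ij : I * I, exists k, rho k = rho ij.1 *m rho ij.2 by
    exists m.
  (* The factors are exchanged because [lin] reverses products. *)
  move=> [i j]; have [k kE] := repP _ (subgroupM (Grep j) (Grep i)).
  by exists k; rewrite /rho kE linM !mulmxA mulmxKV.
have [inv invP] : exists inv, forall i, rho i *m rho (inv i) = 1%:M.
  suff /choice[m mP] : forall i, exists k, rho i *m rho k = 1%:M by exists m.
  move=> i; have [k kE] := repP _ (subgroupV (Grep i)).
  by exists k; rewrite /rho kE linV !mulmxA mulmxKV// -(mulmxA E) lin_orth mulmx1 mulmxV.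
split.
  exists (fun i j => mul (i, j)), inv; split=> //.
  - move=> i j k /= jk; apply: rhoinj; have := mulP (i, j); rewrite jk mulP/= => ijk.
    have ui : rho i \in unitmx by case/mulmx1_unit: (invP i).
    by rewrite -[LHS](mulKmx ui) -ijk mulKmx.
  - move=> i; apply/mxOverP => a b.
    have /TE/mxOverP/(_ 0 b) :=
      translations_lin (normal_subgroup_refl Gamma) (Grep i) (rowT a).
    by rewrite -!row_mul mxE.
move=> i k l kr rl.
have rowN : translations N (row k E).
  apply/LE; rewrite -row_mul mulmxV//; split=> [|j rj].
    by apply/mxOverP => a b; rewrite !mxE; exact: rpred_nat.
  by rewrite !mxE; case: eqP => // kj; move: rj; rewrite -kj leqNgt kr.
have /LE[_ /(_ l rl)] := translations_lin nN (Grep i) rowN.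
by rewrite -!row_mul mxE.
Qed.

Lemma adapted_conj E r Gamma N (P P' : 'M[R]_n) : adapted E r Gamma N ->
  P \is a intmx -> P' \is a intmx -> P *m P' = 1%:M -> lower_block r P ->
    lower_block r P' ->
  adapted (P *m E) r Gamma N /\ invmx (P *m E) = invmx E *m P'.
Proof.
move=> [rn uE TE LE] Pi Pi' PP' lP lP'; have P'P := mulmx1C PP'.
have VE : invmx (P *m E) = invmx E *m P'.
  by apply/esym/mulmx1_invmx; rewrite mulmxA mulmxK.
have intP (z : 'rV[R]_n) : z \is a intmx <-> z *m P' \is a intmx.
  split=> [zi|zi]; first exact: mxOverM.
  by rewrite -[z]mulmx1 -P'P mulmxA mxOverM.
have vanP (z : 'rV[R]_n) : vanishes_from r z <-> vanishes_from r (z *m P').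
  split=> [zi|zi]; first exact: vanishes_mul.
  by rewrite -[z]mulmx1 -P'P mulmxA; exact: vanishes_mul.
split=> //; split=> //.
- by rewrite unitmx_mul uE andbT; case/mulmx1_unit: PP'.
- by move=> x; rewrite VE mulmxA; apply: iff_trans (TE x) (intP _).
- by move=> x; rewrite VE mulmxA -intP -vanP.
Qed.

(* x0 is the barycentre of the images of the origin under coset representatives
   of the translations. *)
Lemma barycentre E r Gamma N (I : finType) (rep : I -> euclid_isometry R n) :
  adapted E r Gamma N -> injective (lin \o rep) -> (forall i, subgroup_set Gamma (rep i)) ->
  (forall g, subgroup_set Gamma g -> exists i, lin (rep i) = lin g) ->
  exists x0 : 'rV[R]_n, forall g, subgroup_set Gamma g ->
    #|I|%:R *: ((g x0 - x0) *m invmx E) \is a intmx.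
Proof.
move=> [rn uE TE LE] repinj Grep repP; have [i0 _] := repP _ (subgroup1 Gamma).
have m0 : #|I|%:R != 0 :> R by rewrite pnatr_eq0 -lt0n; apply/card_gt0P; exists i0.
pose x0 := #|I|%:R^-1 *: \sum_i tr (rep i).
exists x0 => g Gg; rewrite scalemxAl; apply/TE.
(* Left multiplication by g permutes the cosets of the translations; [s] is the permutation of their
   indices. *)
have [s sP] := choice (fun i => repP _ (subgroupM Gg (Grep i))).
have sinj : injective s.
  move=> i j ij; apply: repinj => /=.
  have : lin (g * rep i)%g = lin (g * rep j)%g by rewrite -!sP ij.
  by rewrite !linM => /(can_inj (mulmxK (lin_unit g))).
have -> : #|I|%:R *: (g x0 - x0) = \sum_i (tr (g * rep i)%g - tr (rep (s i))).
  rewrite big_split/= sumrN -(reindex_inj (h := s) (P := xpredT) (F := fun i => tr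
    (rep i)))//.
  rewrite isometry_affine scalerBr scalerDr scalemxAl /x0 !scalerA mulfV// scale1r.
  congr (_ - _); rewrite [RHS](eq_bigr (fun i => tr (rep i) *m lin g + tr g)) => [|i _];
    last exact: trM.
  by rewrite big_split/= mulmx_suml sumr_const scaler_nat.
apply: zmod_set_sum => [|i _]; first exact: translations_zmod.
have l1 : lin (g * rep i / rep (s i))%g = 1%:M by rewrite linM linV sP lin_orthC.
exists (g * rep i / rep (s i))%g; split=> //.
  by apply: subgroup_div => //; exact: subgroupM.
by rewrite trM trV mulNmx -mulmxA sP lin_orthC mulmx1 addrC.
Qed.

End StandardCoordinates.

Lemma standard_coordinates (R : realType) (n : nat) : exists (c : R) (q : nat), (0 < q)%N /\
  forall Gamma N : subgroup (euclid_isometry R n),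
  space_group Gamma -> normal_subgroup N Gamma -> space_group_quotient R Gamma N ->
  exists (r : nat) (E : 'M[R]_n) (x0 : 'rV[R]_n), [/\ adapted E r Gamma N,
    forall g, subgroup_set Gamma g -> E *m lin g *m invmx E \is a intmx,
    forall g, subgroup_set Gamma g -> mx_bounded c (E *m lin g *m invmx E) &
    forall g, subgroup_set Gamma g -> q%:R *: ((g x0 - x0) *m invmx E) \is a intmx].
Proof.
have [c c0 cP] := @flag_action_bound R n; have [M MP] := holonomy_reps (R := R) n.
(* The denominator from [barycentre] is the number of linear parts, which is at most M; the
   factorial is a common multiple of all possible values. *)
exists c, M`!; split=> [|Gamma N sG nN sQ]; first exact: fact_gt0.
have [I [rep [IM Grep repinj repP]]] := MP _ sG.
have [r [E aE]] := adapted_exists sG nN sQ.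
have [[mul [inv arho]] low] := adapted_action nN aE Grep repinj repP.
have rn : (r <= n)%N by case: aE.
have [P [P' [Pi Pi' PP' [lP lP'] Pc]]] := cP r I mul inv _ rn arho low.
have [aE' VE] := adapted_conj aE Pi Pi' PP' lP lP'.
have [x0 x0P] := barycentre aE' repinj Grep repP.
have conjE g : P *m E *m lin g *m invmx (P *m E) = P *m (E *m lin g *m invmx E) *m P'.
  by rewrite VE !mulmxA.
exists r, (P *m E), x0; split=> // g Gg.
- have [i <-] := repP g Gg; rewrite conjE; case: arho => _ _ _ ri.
  by do 2!apply: mxOverM => //; exact: ri.
- by have [i <-] := repP g Gg; rewrite conjE; exact: Pc.
have [i0 _] := repP g Gg.
have /dvdnP[k ->] : (#|I| %| M`!)%N.
  by rewrite dvdn_fact// IM andbT; apply/card_gt0P; exists i0.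
by rewrite natrM -scalerA intmx_natZ// x0P.
Qed.

(** * Coordinates of isometries and finite codes *)

Section Coordinates.
Context {R : realType} {n : nat} (E : 'M[R]_n) (x0 : 'rV[R]_n).
Hypothesis uE : E \in unitmx.
Implicit Types g h : euclid_isometry R n.

Definition lincoord g : 'M[R]_n := E *m lin g *m invmx E.

(** With [lincoord], this describes g in the affine frame with origin x0 and the rows of E as
    basis. *)
Definition trcoord g : 'rV[R]_n := (g x0 - x0) *m invmx E.

Lemma lincoordM g h : lincoord (g * h)%g = lincoord h *m lincoord g.
Proof. by rewrite /lincoord linM !mulmxA mulmxKV. Qed.

Lemma trcoordM g h : trcoord (g * h)%g = trcoord h *m lincoord g + trcoord g.
Proof.
rewrite /trcoord /lincoord !mulmxA mulmxKV// -mulmxDl; congr (_ *m _).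
by rewrite mulmxBl isometry_mulE !isometry_affine; apply/rowP => j; rewrite !mxE; ring.
Qed.

Lemma lincoord1 : lincoord 1%g = 1%:M.
Proof. by rewrite /lincoord lin1 mulmx1 mulmxV. Qed.

Lemma trcoord1 : trcoord 1%g = 0.
Proof. by rewrite /trcoord isometry_1E subrr mul0mx. Qed.

Lemma lincoord_eq1 g : lincoord g = 1%:M <-> lin g = 1%:M.
Proof.
split=> [|g1]; last by rewrite /lincoord g1 mulmx1 mulmxV.
move=> /(congr1 (fun A => invmx E *m A *m E)).
by rewrite /lincoord !mulmxA mulmxKV// mulVmx// mul1mx mulmx1 mulVmx.
Qed.

Lemma trcoord_translation g : lin g = 1%:M -> trcoord g = tr g *m invmx E.
Proof. by move=> g1; rewrite /trcoord isometry_affine g1 mulmx1 addrC addKr. Qed.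

Lemma coord_inj g h : lincoord g = lincoord h -> trcoord g = trcoord h -> g = h.
Proof.
have uE' : invmx E \in unitmx by rewrite unitmx_inv.
move=> /(can_inj (mulmxK uE'))/(can_inj (mulKmx uE)) lgh.
move=> /(can_inj (mulmxK uE'))/addIr; rewrite !isometry_affine lgh => /addrI.
exact: isometry_eq.
Qed.

(** On the right-hand side N appears only through r, which is why the code of a pair need not list
    the elements of N. *)
Lemma normal_coords r (Gamma N : subgroup (euclid_isometry R n)) g :
  space_group Gamma -> normal_subgroup N Gamma -> space_group_quotient R Gamma N ->
  adapted E r Gamma N ->
  subgroup_set N g <-> [/\ subgroup_set Gamma g,
    exists k, [/\ (0 < k)%N, lincoord (g ^+ k)%g = 1%:M, trcoord (g ^+ k)%g \is a intmx &
      vanishes_from r (trcoord (g ^+ k)%g)] &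
    forall z : 'rV[R]_n, z \is a intmx ->
      z *m lincoord g - z \is a intmx /\ vanishes_from r (z *m lincoord g - z)].
Proof.
move=> sG nN sQ [_ _ TE LE]; apply: iff_trans (normal_char g sG nN sQ) _.
have zE (z : 'rV[R]_n) : z *m lincoord g - z = (z *m E *m lin g - z *m E) *m invmx E.
  by rewrite mulmxBl mulmxK// /lincoord !mulmxA.
split=> -[Gg [k kP] gz]; split=> //.
- exists k; case: kP => k0 gk1 Nk; split=> //; first exact/lincoord_eq1.
    by rewrite trcoord_translation//; case/LE: Nk.
  by rewrite trcoord_translation//; case/LE: Nk.
- move=> z zi; rewrite zE; apply/LE; apply: gz; apply/TE.
  by rewrite mulmxK.
- exists k; case: kP => k0 /lincoord_eq1 gk1; rewrite trcoord_translation// => h1 h2.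
  by split=> //; apply/LE.
- move=> x /TE xi; apply/LE; have := gz _ xi.
  by rewrite zE mulmxKV.
Qed.

Lemma translation_coord r (Gamma N : subgroup (euclid_isometry R n)) (z : 'rV[R]_n) :
  adapted E r Gamma N -> z \is a intmx ->
  exists t, [/\ subgroup_set Gamma t, lincoord t = 1%:M & trcoord t = z].
Proof.
move=> [_ _ TE _] zi; have : translations Gamma (z *m E) by apply/TE; rewrite mulmxK.
move=> [t [Gt t1 tz]]; exists t; split=> //; first exact/lincoord_eq1.
by rewrite trcoord_translation// tz mulmxK.
Qed.

Variables (C q : nat).

(** The shift by C makes the ordinals range over the integers from -C to C. *)
Definition liftM (a : 'M['I_(C + C).+1]_n) : 'M[R]_n := \matrix_(i, j) ((a i j)%:R - C%:R).

Definition liftV (b : 'rV['I_q.+1]_n) : 'rV[R]_n := \row_j ((b 0 j)%:R / q.+1%:R).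

(** Only elements with translation coordinates in [0, 1) are listed. In an adapted frame every
    element of Gamma becomes one of these after composition with a translation of Gamma. *)
Definition group_code (Gamma : subgroup (euclid_isometry R n)) :
    {set 'M['I_(C + C).+1]_n * 'rV['I_q.+1]_n} :=
  [set ab | `[< exists g, [/\ subgroup_set Gamma g, lincoord g = liftM ab.1 &
    trcoord g = liftV ab.2] >]]%SET.

Lemma coord_lift g : lincoord g \is a intmx -> mx_bounded C%:R (lincoord g) ->
  q.+1%:R *: trcoord g \is a intmx ->
  exists a b (z : 'rV[R]_n),
    [/\ lincoord g = liftM a, z \is a intmx & trcoord g = liftV b + z].
Proof.
move=> gi gC gq.
have q0 : 0 < q.+1%:R :> R by rewrite ltr0n.
have toN (x : R) : x \is a Num.int -> 0 <= x -> (Num.truncn x)%:R = x.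
  by move=> xi x_ge0; rewrite truncnK// natrEint xi.
have aE i j : exists a : 'I_(C + C).+1, a%:R - C%:R = lincoord g i j.
  have /ler_normlP[h1 h2] := gC i j.
  have a0 : 0 <= lincoord g i j + C%:R by lra.
  have xi : lincoord g i j + C%:R \is a Num.int by rewrite rpredD ?rpred_nat// (mxOverP gi).
  have lt : (Num.truncn (lincoord g i j + C%:R) < (C + C).+1)%N.
    by rewrite ltnS -(ler_nat R) toN// natrD; lra.
  by exists (Ordinal lt); rewrite /= toN// addrK.
have bE j : exists b : 'I_q.+1, b%:R / q.+1%:R = trcoord g 0 j - floormx (trcoord g) 0 j.
  have := floormx_frac (trcoord g) 0 j.
  have -> : (trcoord g - floormx (trcoord g)) 0 j = trcoord g 0 j - floormx (trcoord
    g) 0 j by rewrite !mxE.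
  set y := _ - _ => /andP[y0 y1].
  have yi : q.+1%:R * y \is a Num.int.
    rewrite mulrBr rpredB//; last by rewrite rpredM ?rpred_nat// (mxOverP (floormx_int _)).
    by have /mxOverP/(_ 0 j) := gq; rewrite mxE.
  have yq0 : 0 <= q.+1%:R * y by rewrite mulr_ge0.
  have lt : (Num.truncn (q.+1%:R * y) < q.+1)%N.
    by rewrite -(ltr_nat R) toN// -[ltRHS]mulr1 ltr_pM2l.
  by exists (Ordinal lt); rewrite /= toN// mulrC mulrA mulVf ?mul1r// gt_eqF.
have [fa faP] := choice (fun ij : 'I_n * 'I_n => aE ij.1 ij.2).
have [fb fbP] := choice bE.
exists (\matrix_(i, j) fa (i, j)), (\row_j fb j), (floormx (trcoord g)); split.
- by apply/matrixP => i j; rewrite [RHS]mxE mxE (faP (i, j)).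
- exact: floormx_int.
- by apply/rowP => j; rewrite [RHS]mxE [liftV _ _ _]mxE mxE fbP subrK.
Qed.

End Coordinates.

(** * Isomorphisms from equal codes *)

Section SameCoordinates.
Context {R : realType} {n : nat} (E E' : 'M[R]_n) (x0 x0' : 'rV[R]_n).
Context (Gamma N Gamma' N' : subgroup (euclid_isometry R n)) (r : nat).
Hypotheses (aE : adapted E r Gamma N) (aE' : adapted E' r Gamma' N').
Implicit Types g h : euclid_isometry R n.

Definition same_coords g h :=
  lincoord E g = lincoord E' h /\ trcoord E x0 g = trcoord E' x0' h.

Let uE : E \in unitmx. Proof. by case: aE. Qed.
Let uE' : E' \in unitmx. Proof. by case: aE'. Qed.

Lemma same_coordsM g1 h1 g2 h2 : same_coords g1 h1 -> same_coords g2 h2 ->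
  same_coords (g1 * g2)%g (h1 * h2)%g.
Proof. by move=> [l1 t1] [l2 t2]; split;
  rewrite ?lincoordM ?trcoordM// ?l1 ?l2 ?t1 ?t2. Qed.

Lemma same_coordsX g h k : same_coords g h -> same_coords (g ^+ k)%g (h ^+ k)%g.
Proof.
move=> gh; elim: k => [|k ih]; last by rewrite !expgS; exact: same_coordsM.
by split; rewrite !expg0 ?lincoord1 ?trcoord1.
Qed.

(** A translation of Gamma moves the translation part of g into [0, 1)^n. The equal code supplies a
    partner in Gamma', and the translation of Gamma' with the opposite coordinates undoes the
    move. *)
Lemma same_coords_exists (C q : nat) :
  group_code E x0 C q Gamma = group_code E' x0' C q Gamma' ->
  (forall g, subgroup_set Gamma g -> lincoord E g \is a intmx) ->
  (forall g, subgroup_set Gamma g -> mx_bounded C%:R (lincoord E g)) ->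
  (forall g, subgroup_set Gamma g -> q.+1%:R *: trcoord E x0 g \is a intmx) ->
  forall g, subgroup_set Gamma g -> exists h, subgroup_set Gamma' h /\ same_coords g h.
Proof.
move=> eqc gi gC gq g Gg.
have [a [b [z [lg zi tg]]]] := coord_lift (gi g Gg) (gC g Gg) (gq g Gg).
have zi' : - z \is a intmx by rewrite -[- z]sub0r intmxB//; apply/mxOverP => ? ?;
  rewrite mxE.
have [t [Gt lt tt]] := translation_coord x0 uE aE zi'.
have : (a, b) \in group_code E x0 C q Gamma.
  rewrite inE; apply/asboolP; exists (t * g)%g; split.
  - exact: subgroupM.
  - by rewrite lincoordM// lt mulmx1.
  - by rewrite trcoordM// lt mulmx1 tt tg addrK.
rewrite eqc inE => /asboolP[h [Gh lh th]].
have [t' [Gt' lt' tt']] := translation_coord x0' uE' aE' zi.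
exists (t' * h)%g; split; first exact: subgroupM.
split; first by rewrite lincoordM// lt' mulmx1 lh lg.
by rewrite trcoordM// lt' mulmx1 tt' th tg.
Qed.

Hypotheses (sG : space_group Gamma) (nN : normal_subgroup N Gamma)
  (sQ : space_group_quotient R Gamma N).
Hypotheses (sG' : space_group Gamma') (nN' : normal_subgroup N' Gamma')
  (sQ' : space_group_quotient R Gamma' N').

Lemma same_coords_normal g h : subgroup_set Gamma g -> subgroup_set Gamma' h ->
  same_coords g h -> subgroup_set N g <-> subgroup_set N' h.
Proof.
move=> Gg Gh gh; have ghX k := same_coordsX k gh.
apply: iff_trans (normal_coords x0 uE g sG nN sQ aE) _.
apply: iff_trans _ (iff_sym (normal_coords x0' uE' h sG' nN' sQ' aE')).
split=> -[_ [k [k0 lk tk vk]] zP]; split=> //.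
- by exists k; have [<- <-] := ghX k.
- by case: gh => <- _.
- by exists k; have [-> ->] := ghX k.
- by case: gh => -> _.
Qed.

End SameCoordinates.

Section Classification.
Context {R : realType} {n : nat}.
Implicit Types g h : euclid_isometry R n.

(** The isomorphism is conjugation by the affine map from one frame to the other. It is found
    elementwise, since coordinates determine an isometry, and matches N with N' because both are
    read off from coordinates and the common r. *)
Lemma pair_isomorphic_same_coords (E E' : 'M[R]_n) (x0 x0' : 'rV[R]_n) r
    (Gamma N Gamma' N' : subgroup (euclid_isometry R n)) :
  adapted E r Gamma N -> adapted E' r Gamma' N' ->
  space_group Gamma -> normal_subgroup N Gamma -> space_group_quotient R Gamma N ->
  space_group Gamma' -> normal_subgroup N' Gamma' -> space_group_quotient R Gamma' N' ->
  (forall g, subgroup_set Gamma g -> exists h, subgroup_set Gamma' h /\ same_coords E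
    E' x0 x0' g h) ->
  (forall h, subgroup_set Gamma' h -> exists g, subgroup_set Gamma g /\ same_coords E'
    E x0' x0 h g) ->
  pair_isomorphic (Gamma, N) (Gamma', N').
Proof.
move=> aE aE' sG nN sQ sG' nN' sQ' ex ex'.
have uE : E \in unitmx by case: aE.
have uE' : E' \in unitmx by case: aE'.
have /choice[f fP] g : exists h, subgroup_set Gamma g ->
    subgroup_set Gamma' h /\ same_coords E E' x0 x0' g h.
  have [/ex[h hP]|nG] := pselect (subgroup_set Gamma g); first by exists h.
  by exists 1%g.
have fsurj h : subgroup_set Gamma' h -> exists g, [/\ subgroup_set Gamma g, f g = h &
    same_coords E E' x0 x0' g h].
  move=> Gh; have [g [Gg [l t]]] := ex' h Gh; exists g; split=> //.
  have [_ [l' t']] := fP g Gg.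
  by apply: (coord_inj uE' (x0 := x0')); rewrite -?l' -?t' ?l ?t.
have NG := nN.1; have NG' := nN'.1.
exists f; split; [split; [split|]|] => /=.
- by move=> g Gg; case: (fP g Gg).
- move=> g h /set_mem Gg /set_mem Gh fgh; have [_ [l t]] := fP g Gg; have [_ [l' t']] :=
  fP h Gh.
  by apply: (coord_inj uE (x0 := x0)); rewrite ?l ?t ?l' ?t' fgh.
- by move=> h Gh; have [g [Gg fg _]] := fsurj h Gh; exists g.
- move=> g h Gg Gh; have [_ [l t]] := fP _ (subgroupM Gg Gh).
  have [_ gg] := fP g Gg; have [_ hh] := fP h Gh.
  have [l' t'] := same_coordsM aE aE' gg hh.
  by apply: (coord_inj uE' (x0 := x0')); rewrite -?l -?t ?l' ?t'.
have Nf g h : subgroup_set Gamma g -> subgroup_set Gamma' h ->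
  same_coords E E' x0 x0' g h ->
    subgroup_set N g <-> subgroup_set N' h.
  by move=> Gg Gh; exact: (same_coords_normal aE aE' sG nN sQ sG' nN' sQ' Gg Gh).
apply/seteqP; split=> [_ [g Ng <-]|h Nh].
  have Gg := NG _ Ng; have [Gf sf] := fP g Gg.
  by apply/(Nf g).
have [g [Gg fg sgh]] := fsurj h (NG' _ Nh).
by exists g => //; apply/(Nf g h Gg (NG' _ Nh) sgh).
Qed.

Lemma pair_isomorphic_trans (G1 G2 G3 : groupType) (p1 : subgroup G1 * subgroup G1)
    (p2 : subgroup G2 * subgroup G2) (p3 : subgroup G3 * subgroup G3) :
  pair_isomorphic p1 p2 -> pair_isomorphic p2 p3 -> pair_isomorphic p1 p3.
Proof.
move=> [f [[[ff fi fs] fM] fN]] [g [[[gf gi gs] gM] gN]]; exists (g \o f).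
split; last by rewrite -gN -fN image_comp.
split=> [|x y Hx Hy]; last by rewrite /= fM// gM//; exact: ff.
split=> [x Hx|x y|z Hz].
- by apply: gf; exact: ff.
- rewrite !inE => Hx Hy /= fg; apply: fi; rewrite ?inE//.
  by apply: gi => //; rewrite inE; exact: ff.
- by have [y Hy <-] := gs z Hz; have [x Hx <-] := fs y Hy; exists x.
Qed.

End Classification.

Lemma finite_image_code (T U : Type) (C : finType) (A : set T) (code : T -> C) (F : T
  -> U) :
  (forall x y, A x -> A y -> code x = code y -> F x = F y) -> finite_set (F @` A).
Proof.
move=> codeF; have [->|/set0P[t0 At0]] := eqVneq A set0; first by rewrite image_set0.
have /choice[t tP] c : exists t, A t /\ ((exists2 x, A x & code x = c) -> code t = c).
  have [[x Ax xc]|nx] := pselect (exists2 x, A x & code x = c); first by exists x.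
  by exists t0.
apply: (@sub_finite_set _ _ ((F \o t) @` [set: C])); last first.
  by apply: finite_image; exact: finite_finset.
move=> _ [x Ax <-]; exists (code x) => //=; have [At tx] := tP (code x).
by apply: codeF => //; apply: tx; exists x.
Qed.

Theorem theorem4 (R : realType) (n : nat) :
  finite_set [set pair_class p | p in space_group_pairs R n].
Proof.
(* The positive denominator is rewritten as [q.+1] to fit the ordinals of [liftV]. *)
have [c [q' [q'0 std]]] := standard_coordinates R n; case: q' q'0 std => // q _ std.
pose C := Num.bound `|c|.
pose T := ('I_n.+1 * ('M[R]_n * 'rV[R]_n))%type.
have /choice[d dP] (p : subgroup (euclid_isometry R n) * subgroup (euclid_isometry R n)) :
    exists d : T, space_group_pairs R n p -> [/\ adapted d.2.1 d.1 p.1 p.2,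
      forall g, subgroup_set p.1 g -> lincoord d.2.1 g \is a intmx,
      forall g, subgroup_set p.1 g -> mx_bounded C%:R (lincoord d.2.1 g) &
      forall g, subgroup_set p.1 g -> q.+1%:R *: trcoord d.2.1 d.2.2 g \is a intmx].
  have [[sG nN sQ]|np] := pselect (space_group_pairs R n p); last by exists (ord0, (0, 0)).
  have [r [E [x0 [aE gi gc gq]]]] := std _ _ sG nN sQ.
  have rn : (r < n.+1)%N by rewrite ltnS; case: aE.
  exists (Ordinal rn, (E, x0)) => _; split=> //= g Gg.
  apply: mx_boundedW (gc g Gg); rewrite /C.
  by rewrite (le_trans (ler_norm c))// ltW// archi_boundP.
(* The frame itself ranges over an infinite set and is left out; the rank and the finite set of
   coordinates suffice. *)
pose code p := ((d p).1, group_code (d p).2.1 (d p).2.2 C q p.1).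
have iso p p' : space_group_pairs R n p -> space_group_pairs R n p' -> code p = code p' ->
    pair_isomorphic p p'.
  move=> Pp Pp' [dd cc]; have [aE gi gC gq] := dP p Pp; have [aE' gi' gC' gq'] := dP p' Pp'.
  rewrite -dd in aE'; case: Pp Pp' => [sG nN sQ] [sG' nN' sQ'].
  rewrite [p]surjective_pairing [p']surjective_pairing.
  apply: (pair_isomorphic_same_coords aE aE') => //.
  - exact: (same_coords_exists aE aE' cc).
  - exact: (same_coords_exists aE' aE (esym cc)).
apply: (finite_image_code (code := code)) => p p' Pp Pp' pp'.
apply/seteqP; split=> t [Pt pt]; split=> //; apply: pair_isomorphic_trans pt; exact: iso.
Qed.
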